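(* Let $M$ be a closed connected 7-dimensional spin manifold with a fixed spin structure. Under the correspondence $\Omega:\Sigma_1\to\Lambda^3_+$, $\Omega(g,\psi)_{abc}=\langle e_a\cdot e_b\cdot e_c\cdot\psi,\psi\rangle_g$ ($\{e_a\}$ a $g$-orthonormal frame), the horizontal distribution of Bourguignon and Gauduchon on $\Sigma_1$ identifies with the distribution on $\Lambda^3_+$ given, at $\omega\in\Lambda^3_+$ over $x\in M$, by $$\Lambda^3_{28}(\omega)=\{i_\omega(h)\mid h\in S^2T^*_xM\}.$$ In particular this distribution is not integrable. Furthermore, if $(g_t,\psi_t)$ is a horizontal curve in $\Sigma_1$, then $\omega_t=\Omega(g_t,\psi_t)$ has velocity $\frac32\,i_{\omega_t}(\dot g_t)$.
   Context: Setting. The spin structure is a double cover $\widetilde{\mathcal P}\to\mathcal P$ of the bundle of oriented frames by a principal $\widetilde{\mathrm{GL}}^+$-bundle ($\widetilde{\mathrm{GL}}^+$ the universal cover of $\mathrm{GL}^+(7,\mathbb R)$). $\Delta_7$ is the real spin module (dimension 8; convention $x\cdot x=-|x|^2$; $\mathrm{Spin}(7)$-invariant scalar product). The universal spinor bundle is $\Sigma=\widetilde{\mathcal P}\times_{\mathrm{Spin}(7)}\Delta_7$; its points over $x\in M$ are pairs $(g,\psi)$ with $g$ an inner product on $T_xM$ and $\psi$ a $g$-spinor at $x$. $\Sigma_1\subset\Sigma$ is the set of pairs with $|\psi|_g=1$. Horizontal distribution. For inner products $g,g'$ on $T_xM$ let $B_{g'}^{g}$ be the unique $g'$-symmetric positive-definite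 square root of the endomorphism $A$ defined by $g(X,Y)=g'(AX,Y)$; it maps $g$-orthonormal frames to $g'$-orthonormal frames. At $s=[\sigma,v]\in\Sigma_1$ over $x$ with metric $g$, the horizontal space is $H_s=\{\frac{d}{dt}|_{t=0}[\widetilde B_{g+th}^{g}\sigma,v]: h\in S^2T_x^*M\}$, where $\widetilde B_{g+th}^g\sigma$ is the lift to $\widetilde{\mathcal P}$, starting at $\sigma$, of $B_{g+th}^g$ applied to the frame under $\sigma$. Horizontal curves are curves (in a fibre over a fixed $x$) tangent to $H$. Positive forms. $\Lambda^3_+\subset\Lambda^3T^*M$ is the open set of three-forms pointwise $\mathrm{GL}$-equivalent to the forms $\Omega(g,\psi)$ with $|\psi|_g=1$; each $\omega\in\Lambda^3_+$ determines its metric $g_\omega$, and $\Omega:\Sigma_1\to\Lambda^3_+$ is a two-fold covering. For $\omega\in\Lambda^3_+$ and a symmetric 2-tensor $h$, $i_\omega(h)_{abc}=h_{[a|i|}\,\omega^{i}{}_{bc]}$, where indices are raised with $g_\omega$ and $[\,\cdot\,]$ is skew-symmetrisation over $a,b,c$ including the factor $1/3!$. *)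

(* Defs.v *)
From HB Require Import structures.
From mathcomp Require Import all_boot all_order all_algebra generic_quotient.
From mathcomp Require Import all_classical all_reals all_analysis.

Set Implicit Arguments.
Unset Strict Implicit.
Unset Printing Implicit Defensive.

Import Order.TTheory GRing.Theory Num.Theory.
Import numFieldNormedType.Exports.

Local Open Scope classical_set_scope.
Local Open Scope ring_scope.
Local Open Scope quotient_scope.

(** * Smooth maps between open sets of normed spaces *)

Fixpoint Ck (R : realType) (V W : normedModType R) (k : nat) (U : set V)
    (f : V -> W) : Prop :=
  match k with
  | 0 => forall p, U p -> {for p, continuous f}
  | k'.+1 => (forall p, U p -> differentiable f p) /\
             (forall v : V, Ck k' U ('D_v f))
  end.

Definition smooth_on (R : realType) (V W : normedModType R) (U : set V)
    (f : V -> W) : Prop :=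
  open U /\ forall k, Ck k U f.

Definition jacobian_mx (R : realType) (m n : nat)
    (f : 'cV[R]_m -> 'cV[R]_n) (p : 'cV[R]_m) : 'M[R]_(n, m) :=
  \matrix_(i, j) ('D_(delta_mx j 0) f p) i 0.

(** * The real spin module and Spin(7) *)

(** [Delta_7] is [R^8] with its standard scalar product.  A vector [X] of [R^7]
    acts by [cliff C X]; skewness of this action says that unit vectors act
    orthogonally, hence that the scalar product is Spin(7)-invariant.
    Both eight-dimensional Clifford modules (differing by the sign of the
    action, and equal as Spin(7)-modules) are allowed. *)
Record clifford_module (R : realType) := CliffordModule {
  gam : 'I_7 -> 'M[R]_8;
  gam_rel : forall a b,
    gam a *m gam b + gam b *m gam a = (- (2 * (a == b)%:R))%:M;
  gam_skew : forall a, (gam a)^T = - gam a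
}.

Definition cliff (R : realType) (C : clifford_module R) (X : 'cV[R]_7) :
    'M[R]_8 :=
  \sum_a X a 0 *: gam C a.

Definition dotp (R : realType) (n : nat) (u v : 'cV[R]_n) : R :=
  (u^T *m v) 0 0.

(** [Delta_7] is a faithful Spin(7)-module, so Spin(7) is identified with its
    image in the endomorphisms of [Delta_7]. *)
Definition Spin7 (R : realType) (C : clifford_module R) : set 'M[R]_8 :=
  [set u | exists s : seq 'cV[R]_7,
     [/\ ~~ odd (size s),
         forall X, X \in s -> dotp X X = 1
       & u = \big[mulmx/1%:M]_(X <- s) cliff C X]].

(** * The universal cover of GL^+(7, R) *)

#[short(type="groupTopologicalType")]
HB.structure Definition GroupTopological := {G of Group G & Topological G}.

Definition topological_group (G : groupTopologicalType) : Prop :=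
  continuous (fun p : G * G => (p.1 * p.2)%g) /\
  continuous (fun g : G => (g^-1)%g).

Definition GLp (R : realType) : set 'M[R]_7 := [set A | 0 < \det A].
Definition SO7 (R : realType) : set 'M[R]_7 :=
  [set A | A^T *m A = 1%:M /\ \det A = 1].
Arguments GLp : clear implicits.
Arguments SO7 : clear implicits.

Definition evenly_covered (X Y : topologicalType) (p : X -> Y) (V : set Y) :
    Prop :=
  exists (I : Type) (W : I -> set X),
    [/\ forall i, open (W i),
        trivIset setT W,
        \bigcup_i W i = p @^-1` V
      & forall i, exists q : Y -> X,
          [/\ {within V, continuous q},
              forall y, V y -> W i (q y) /\ p (q y) = y
            & forall x, W i x -> q (p x) = x]].

Definition covering_onto (X Y : topologicalType) (p : X -> Y) (Y0 : set Y) :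
    Prop :=
  [/\ continuous p, set_surj setT Y0 p, forall x, Y0 (p x)
    & forall y, Y0 y ->
        exists V, [/\ open V, V y, V `<=` Y0 & evenly_covered p V]].

Definition path_connected (R : realType) (X : topologicalType) : Prop :=
  forall x y : X, exists c : R -> X,
    [/\ {within `[0, 1], continuous c}, c 0 = x & c 1 = y].

Definition simply_connected (R : realType) (X : topologicalType) : Prop :=
  path_connected R X /\
  forall c : R -> X, {within `[0, 1], continuous c} -> c 0 = c 1 ->
  exists H : R * R -> X,
    [/\ {within `[0, 1]%classic `*` `[0, 1]%classic, continuous H},
        forall r, r \in `[0, 1] -> H (r, 0) = c r,
        forall r, r \in `[0, 1] -> H (r, 1) = c 0
      & forall t, t \in `[0, 1] -> H (0, t) = c 0 /\ H (1, t) = c 0].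

Record universal_cover_GLp (R : realType) := UniversalCoverGLp {
  gl_cover :> groupTopologicalType;
  rho : gl_cover -> 'M[R]_7;
  gl_topgroup : topological_group gl_cover;
  rhoM : forall g h, rho (g * h)%g = rho g *m rho h;
  rho_covering : covering_onto rho (GLp R);
  gl_simply_connected : simply_connected R gl_cover
}.

(** The subgroup of the universal cover lying over SO(7) is identified with
    Spin(7), compatibly with the two projections to SO(7). *)
Definition spin_subgroup (R : realType) (G : universal_cover_GLp R) : set G :=
  [set k | SO7 R (rho k)].

Record spin_identification (R : realType) (C : clifford_module R)
    (G : universal_cover_GLp R) := SpinIdentification {
  kappa : G -> 'M[R]_8;
  kappa1 : kappa 1%g = 1%:M;
  kappaM : forall k l, spin_subgroup k -> spin_subgroup l ->
    kappa (k * l)%g = kappa k *m kappa l;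
  kappa_continuous : {within @spin_subgroup R G, continuous kappa};
  kappa_bij : set_bij (@spin_subgroup R G) (Spin7 C) kappa;
  kappa_cliff : forall k X, spin_subgroup k ->
    kappa k *m cliff C X = cliff C (rho k *m X) *m kappa k
}.

(** * Closed connected oriented seven-manifolds *)

(** [T_x M] is the space ['cV[R]_7] of coordinates of tangent vectors in the
    preferred chart [chart_at x]. *)
Record closed_manifold7 (R : realType) := ClosedManifold7 {
  mpt :> topologicalType;
  m_hausdorff : hausdorff_space mpt;
  m_compact : compact [set: mpt];
  m_connected : connected [set: mpt];
  m_index : Type;
  chart_dom : m_index -> set mpt;
  chart : m_index -> mpt -> 'cV[R]_7;
  chart_inv : m_index -> 'cV[R]_7 -> mpt;
  chart_at : mpt -> m_index;
  chart_at_dom : forall x, chart_dom (chart_at x) x;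
  chart_dom_open : forall i, open (chart_dom i);
  chart_img_open : forall i, open (chart i @` chart_dom i);
  chartK : forall i x, chart_dom i x -> chart_inv i (chart i x) = x;
  chart_cont : forall i x, chart_dom i x -> {for x, continuous (chart i)};
  chart_inv_cont : forall i p, (chart i @` chart_dom i) p ->
    {for p, continuous (chart_inv i)};
  transition_smooth : forall i j,
    smooth_on (chart i @` (chart_dom i `&` chart_dom j))
              (chart j \o chart_inv i);
  transition_oriented : forall i j x, chart_dom i x -> chart_dom j x ->
    0 < \det (jacobian_mx (chart j \o chart_inv i) (chart i x))
}.

(** Coordinate change on [T_x M] from the preferred chart to the chart [i]. *)
Definition to_chart (R : realType) (M : closed_manifold7 R)
    (i : m_index M) (x : M) : 'M[R]_7 :=
  jacobian_mx (chart i \o chart_inv (chart_at x)) (chart (chart_at x) x).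

(** * Spin structures *)

(** A point [sigma] of the total space lies over the frame of [T_(base sigma) M]
    formed by the columns of [frame sigma].  Being continuous and
    [rho]-equivariant between principal bundles, the map
    [sigma |-> (base sigma, frame sigma)] to the bundle of oriented frames is a
    double cover. *)
Record spin_structure (R : realType) (G : universal_cover_GLp R)
    (M : closed_manifold7 R) := SpinStructure {
  spt :> topologicalType;
  base : spt -> M;
  frame : spt -> 'M[R]_7;
  sact : spt -> G -> spt;
  base_cont : continuous base;
  frame_oriented : forall sigma, GLp R (frame sigma);
  frame_cont : forall i sigma, chart_dom i (base sigma) ->
    {for sigma, continuous (fun tau => to_chart i (base tau) *m frame tau)};
  sact_cont : continuous (fun p : spt * G => sact p.1 p.2);
  sact1 : forall sigma, sact sigma 1%g = sigma;
  sactM : forall sigma g h, sact sigma (g * h)%g = sact (sact sigma g) h;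
  base_sact : forall sigma g, base (sact sigma g) = base sigma;
  frame_sact : forall sigma g, frame (sact sigma g) = frame sigma *m rho g;
  sact_trivial : forall x, exists (U : set M) (s : M * G -> spt) (q : spt -> G),
    [/\ open U /\ U x,
        forall y g, U y -> base (s (y, g)) = y /\ q (s (y, g)) = g,
        forall sigma, U (base sigma) -> s (base sigma, q sigma) = sigma,
        forall y g h, U y -> s (y, (g * h)%g) = sact (s (y, g)) h
      & (forall p, U p.1 -> {for p, continuous s}) /\
        (forall sigma, U (base sigma) -> {for sigma, continuous q})]
}.

(** * The universal spinor bundle *)

Section UniversalSpinorBundle.
Context (R : realType) (C : clifford_module R) (G : universal_cover_GLp R)
  (K : spin_identification C G) (M : closed_manifold7 R)
  (S : spin_structure G M).

Definition spinor_rel (p q : S * 'cV[R]_8) : bool :=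
  `[< exists k : G, [/\ spin_subgroup k, q.1 = sact p.1 k
                      & p.2 = kappa K k *m q.2] >].

Lemma spin_subgroup1 : spin_subgroup (1%g : G).
Proof.
have r1 : rho (1%g : G) = 1%:M.
  have u : rho (1%g : G) \in unitmx.
    case: (rho_covering G) => _ _ /(_ 1%g) + _; rewrite /GLp /= unitmxE unitfE.
    by move=> /gt_eqF ->.
  have e := rhoM (1%g : G) 1%g; rewrite mulg1 in e.
  by rewrite -[LHS](mulKmx u) -e mulVmx.
by split; rewrite r1 ?det1 // trmx1 mulmx1.
Qed.

Lemma spin_subgroupM (k l : G) :
  spin_subgroup k -> spin_subgroup l -> spin_subgroup (k * l)%g.
Proof.
move=> [ok dk] [ol dl]; split; rewrite rhoM; last by rewrite det_mulmx dk dl mulr1.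
by rewrite trmx_mul -mulmxA (mulmxA _ (rho k)) ok mul1mx.
Qed.

Lemma spin_subgroupV (k : G) : spin_subgroup k -> spin_subgroup (k^-1)%g.
Proof.
move=> kk; have [ok dk] := kk; have [u1 d1] := spin_subgroup1.
have r1 : rho (1%g : G) = 1%:M.
  have e := rhoM (1%g : G) 1%g; rewrite mulg1 in e.
  by rewrite -[LHS]mul1mx -u1 -mulmxA -e.
have e : rho k *m rho (k^-1)%g = 1%:M by rewrite -rhoM mulgV r1.
have rV : rho (k^-1)%g = (rho k)^T.
  by rewrite -[LHS]mul1mx -ok -mulmxA e mulmx1.
split; rewrite rV ?det_tr // trmxK.
by rewrite -rV.
Qed.

Lemma spinor_rel_refl : reflexive spinor_rel.
Proof.
move=> p; apply/asboolP; exists 1%g; split; first exact: spin_subgroup1.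
  by rewrite sact1.
by rewrite kappa1 mul1mx.
Qed.

Lemma spinor_rel_impl p q : spinor_rel p q -> spinor_rel q p.
Proof.
move=> /asboolP[k [kk e1 e2]]; apply/asboolP; exists (k^-1)%g; split.
- exact: spin_subgroupV.
- by rewrite e1 -sactM mulgV sact1.
- rewrite e2 mulmxA -kappaM //; last exact: spin_subgroupV.
  by rewrite mulVg kappa1 mul1mx.
Qed.

Lemma spinor_rel_sym : symmetric spinor_rel.
Proof. by move=> p q; apply/idP/idP; exact: spinor_rel_impl. Qed.

Lemma spinor_rel_trans : transitive spinor_rel.
Proof.
move=> q p r /asboolP[k [kk e1 e2]] /asboolP[l [ll f1 f2]].
apply/asboolP; exists (k * l)%g; split; first exact: spin_subgroupM.
  by rewrite f1 e1 sactM.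
by rewrite e2 f2 mulmxA -kappaM.
Qed.

Canonical spinor_equiv :=
  EquivRel spinor_rel spinor_rel_refl spinor_rel_sym spinor_rel_trans.

Definition Sigma := {eq_quot spinor_equiv}.

(** The point [sigma, v] of the associated bundle. *)
Definition spinor_class (sigma : S) (v : 'cV[R]_8) : Sigma :=
  \pi_Sigma (sigma, v).

(** The following functions of a spinor are defined on a representative
    [(sigma, v)]; they do not depend on it. *)

Definition sbase (s : Sigma) : M := base (repr s).1.

(** The inner product (as a Gram matrix on [T_x M]) for which the frame under
    [sigma] is orthonormal. *)
Definition metric (s : Sigma) : 'M[R]_7 :=
  let theta := invmx (frame (repr s).1) in theta^T *m theta.

Definition spinor_norm (s : Sigma) : R :=
  Num.sqrt (dotp (repr s).2 (repr s).2).

Definition Sigma1 (x : M) : set Sigma :=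
  [set s | sbase s = x /\ spinor_norm s = 1].

(** Three-forms on [T_x M] are given by their components in the coordinate
    basis.  In the orthonormal frame under [sigma] the components of
    [Omega s] are [<gam a gam b gam c v, v>]. *)
Definition form3 := 'I_7 -> 'I_7 -> 'I_7 -> R.

Definition Omega (s : Sigma) : form3 := fun i j k =>
  let theta := invmx (frame (repr s).1) in
  let v := (repr s).2 in
  \sum_a \sum_b \sum_c theta a i * theta b j * theta c k *
    dotp (gam C a *m (gam C b *m (gam C c *m v))) v.

(** * Positive three-forms *)

Definition pullback3 (A : 'M[R]_7) (w : form3) : form3 := fun i j k =>
  \sum_a \sum_b \sum_c A a i * A b j * A c k * w a b c.

(** Equivalence is under [GL^+(T_x M)], as [M] is oriented; this is what makes
    [Omega] a covering of the positive forms. *)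
Definition Lambda3p (x : M) : set form3 :=
  [set w | exists (s : Sigma) (A : 'M[R]_7),
     [/\ Sigma1 x s, GLp R A & w = pullback3 A (Omega s)]].

Definition metric_of (x : M) (w : form3) : 'M[R]_7 :=
  get [set g | exists s, [/\ Sigma1 x s, Omega s = w & metric s = g]].

Definition skew3 (T : form3) : form3 := fun a b c =>
  6^-1 * (T a b c + T b c a + T c a b - T b a c - T a c b - T c b a).

Definition symmetric2 (h : 'M[R]_7) : Prop := h^T = h.

Definition i_op (x : M) (w : form3) (h : 'M[R]_7) : form3 :=
  skew3 (fun a b c =>
    \sum_i \sum_j h a i * invmx (metric_of x w) i j * w j b c).

Definition Lambda28 (x : M) (w : form3) : set form3 :=
  [set i_op x w h | h in symmetric2].

(** * Smooth structure on the fibre of [Sigma] over [x] *)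

(** Locally, the smooth structure is the quotient of the one of the product of
    the fibre of the spin structure (a covering of the frames of [T_x M]) with
    [Delta_7]. *)

Definition smooth_fun (x : M) (f : Sigma -> R) : Prop :=
  forall (sigma0 : S) (v0 : 'cV[R]_8), base sigma0 = x ->
  exists (W : set S) (U : set ('M[R]_7 * 'cV[R]_8)%type)
         (F : ('M[R]_7 * 'cV[R]_8)%type -> R),
    [/\ open W /\ W sigma0, U (frame sigma0, v0), smooth_on U F
      & forall sigma v, W sigma -> base sigma = x -> U (frame sigma, v) ->
          f (spinor_class sigma v) = F (frame sigma, v)].

Definition smooth_curve (x : M) (I : set R) (c : R -> Sigma) : Prop :=
  forall t0, I t0 ->
  exists (U : set R) (l : R -> S) (v : R -> 'cV[R]_8),
    [/\ U t0, smooth_on U (fun t => frame (l t)), smooth_on U v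
      & forall t, U t -> [/\ {for t, continuous l}, base (l t) = x
                           & c t = spinor_class (l t) (v t)]].

(** Tangent vectors are derivations of smooth functions.  They are extended by
    0 to all functions, so that equality as functionals is equality as tangent
    vectors. *)
Definition tangent_vector := (Sigma -> R) -> R.

Definition velocity (x : M) (c : R -> Sigma) (t : R) : tangent_vector :=
  fun f => if `[< smooth_fun x f >] then derive1 (f \o c) t else 0.

Definition dOmega (X : tangent_vector) : form3 := fun i j k =>
  X (fun s => Omega s i j k).

(** * The horizontal distribution *)

Definition posdef (n : nat) (A : 'M[R]_n) : Prop :=
  A^T = A /\ forall X : 'cV[R]_n, X != 0 -> 0 < (X^T *m A *m X) 0 0.

(** [g(X, Y) = g'(A X, Y)] reads [A = g'^-1 g] for Gram matrices, and an
    endomorphism [B] is [g']-symmetric positive when [g' B] is. *)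
Definition BG (g g' : 'M[R]_7) : 'M[R]_7 :=
  get [set B | posdef (g' *m B) /\ B *m B = invmx g' *m g].

Definition horizontal_lift (sigma : S) (g h : 'M[R]_7) (l : R -> S) : Prop :=
  l 0 = sigma /\
  \forall t \near (0 : R),
    [/\ {for t, continuous l}, base (l t) = base sigma
      & frame (l t) = BG g (g + t *: h) *m frame sigma].

Definition horizontal (x : M) (s : Sigma) : set tangent_vector :=
  [set X | exists (sigma : S) (v : 'cV[R]_8) (h : 'M[R]_7) (l : R -> S),
     [/\ base sigma = x /\ s = spinor_class sigma v,
         symmetric2 h,
         horizontal_lift sigma (metric s) h l
       & X = velocity x (fun t => spinor_class (l t) v) 0]].

Definition horizontal_curve (x : M) (a b : R) (c : R -> Sigma) : Prop :=
  smooth_curve x `]a, b[ c /\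
  forall t, t \in `]a, b[ ->
    Sigma1 x (c t) /\ horizontal x (c t) (velocity x c t).

(** * Integrability *)

(** A rank-[n] distribution [D] on the open set [P] of three-forms is integrable
    when an [n]-dimensional (immersed) integral manifold, here given by a local
    parametrisation [f], passes through each point of [P]. *)
Definition integrable_distribution (n : nat) (P : set form3)
    (D : form3 -> set form3) : Prop :=
  forall w, P w ->
  exists (U : set 'cV[R]_n) (f : 'cV[R]_n -> form3) (u0 : 'cV[R]_n),
    [/\ U u0, f u0 = w,
        forall i j k, smooth_on U (fun u => f u i j k),
        forall u, U u -> P (f u)
      & forall u, U u -> set_bij setT (D (f u))
          (fun (v : 'cV[R]_n) i j k => 'D_v (fun y => f y i j k) u)].

End UniversalSpinorBundle.

(* Main.v *)
(** A unit spinor [v] splits Delta_7 as the line of [v] plus the image of the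
    isometry [E : x |-> x . v]. For symmetric [h] the Clifford action of the form
    i(h) is [tr h (8 v v^T - 2) + 8 E h E^T], so i is injective and traces
    against i(h) are explicit.

    A horizontal lift in the direction [h] moves the coframe by the square root of
    1 + th, up to order one 1 + th/2. Hence Omega moves by pullback along this
    root, and inserting h/2 in each of the three slots gives 3/2 i(h). Bryant's
    7-form-valued bilinear form (x _| w) /\ (y _| w) /\ w shows that the form
    determines the metric, which is what makes dOmega a bijection.

    Finally b /\ w = 0 for every b in Lambda^3_28(w). On an integral manifold this
    can be differentiated: as second derivatives commute and the wedge of 3-forms is
    skew, b1 /\ b2 = 0 for all b1, b2 in Lambda^3_28, while
    i(h) /\ i(k) /\ x is a multiple of tr (h k E^T x E), which is not always zero. *)

Require Import Defs.
From HB Require Import structures.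
From mathcomp Require Import all_boot all_order all_algebra all_fingroup.
From mathcomp Require Import generic_quotient complex.
From mathcomp Require Import all_classical all_reals all_analysis.
From mathcomp Require Import ring lra.

Set Implicit Arguments.
Unset Strict Implicit.
Unset Printing Implicit Defensive.

Import Order.TTheory GRing.Theory Num.Theory.
Import numFieldNormedType.Exports.

Local Open Scope classical_set_scope.
Local Open Scope ring_scope.

(** A point [sigma, v] of Sigma_1 enters only through v and the coframe th = [invmx (frame sigma)]:
    [Omega] is the pullback along th of the model form [spinor_form], and the metric is th^T th.
    Algebraic questions are therefore settled in an orthonormal frame and transported by
    [pullback3]. Exterior products of total degree seven become traces of Clifford matrices: a trace
    of seven vectors changes by det A when each of them is transformed by A, even for A not
    orthogonal, and this gives covariance under GL. Two obstacles come from the definitions.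
    [metric_of] and [BG] are values of [get], so they can be computed only once uniqueness of the
    metric of a form and of the positive square root is known. Tangent vectors are derivations, so
    injectivity of [dOmega] takes more than recovering h from i(h): two horizontal lifts with the
    same h have to act equally on all smooth functions. *)

Section ScalarProduct.
Context (R : realType) (n : nat).
Implicit Types (u v : 'cV[R]_n) (A : 'M[R]_n).

Lemma dotpE u v : dotp u v = \sum_i u i 0 * v i 0.
Proof. by rewrite /dotp mxE; apply: eq_bigr => i _; rewrite mxE. Qed.

Lemma dotpC u v : dotp u v = dotp v u.
Proof. by rewrite !dotpE; apply: eq_bigr => i _; rewrite mulrC. Qed.

Lemma dotpDl u u' v : dotp (u + u') v = dotp u v + dotp u' v.
Proof. by rewrite /dotp linearD mulmxDl mxE. Qed.

Lemma dotpZl a u v : dotp (a *: u) v = a * dotp u v.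
Proof. by rewrite /dotp linearZ -scalemxAl mxE. Qed.

Lemma dotpNl u v : dotp (- u) v = - dotp u v.
Proof. by rewrite /dotp linearN mulNmx mxE. Qed.

Lemma dotp_suml I (r : seq I) (F : I -> 'cV[R]_n) v :
  dotp (\sum_(i <- r) F i) v = \sum_(i <- r) dotp (F i) v.
Proof. by rewrite /dotp linear_sum mulmx_suml summxE. Qed.

Lemma dotp_mulmx A u v : dotp (A *m u) v = dotp u (A^T *m v).
Proof. by rewrite /dotp trmx_mul mulmxA. Qed.

End ScalarProduct.

(** * The three-form of a unit spinor and its contractions *)

Section UnitSpinor.
Context (R : realType) (C : clifford_module R).
Local Notation g := (gam C).

Lemma gam_sq a : g a *m g a = - 1%:M.
Proof.
have h := gam_rel C a a; apply/matrixP => i j.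
move/matrixP/(_ i j): h; rewrite eqxx mulr1 !mxE.
by case: eqP => _ h; move: h; rewrite ?mulr1n ?mulr0n; lra.
Qed.

Lemma gamC a b : g a *m g b = - (g b *m g a) - (2 * (a == b)%:R)%:M.
Proof. by apply/eqP; rewrite -subr_eq0 opprD !opprK addrA gam_rel raddfN addNr. Qed.

Lemma dotp_gam a u u' : dotp (g a *m u) u' = - dotp u (g a *m u').
Proof. by rewrite dotp_mulmx gam_skew mulNmx dotpC dotpNl dotpC. Qed.

Lemma dotp_gamM a b u : dotp (g a *m u) (g b *m u) = (a == b)%:R * dotp u u.
Proof.
have h : dotp (g a *m (g b *m u)) u + dotp (g b *m (g a *m u)) u
         = - (2 * ((a == b)%:R * dotp u u)).
  by rewrite -dotpDl !mulmxA -mulmxDl gam_rel mul_scalar_mx dotpZl; ring.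
rewrite !(dotp_gam _ _ u) [dotp (g b *m u) _]dotpC in h.
lra.
Qed.

Lemma dotp_gam0 a u : dotp (g a *m u) u = 0.
Proof. by have := dotp_gam a u u; rewrite [dotp u _]dotpC => h; lra. Qed.

Variable v : 'cV[R]_8.

Definition spinor_form : form3 R := fun a b c =>
  dotp (g a *m (g b *m (g c *m v))) v.
Local Notation w := spinor_form.

(** Anticommuting the first two factors costs a multiple of <e_c v, v>, which is zero because e_c
    acts skewly. *)
Lemma spinor_form_swap12 a b c : w a b c = - w b a c.
Proof.
rewrite {1}/spinor_form mulmxA gamC mulmxBl mulNmx dotpDl dotpNl -mulmxA.
by rewrite mul_scalar_mx dotpNl dotpZl dotp_gam0 mulr0 subr0.
Qed.

Lemma spinor_form_rev a b c : w a b c = - w c b a.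
Proof.
rewrite {1}/spinor_form !dotp_gam.
by rewrite dotpC !opprK.
Qed.

Lemma spinor_form_cyc a b c : w a b c = w b c a.
Proof.
by rewrite spinor_form_swap12 spinor_form_rev opprK spinor_form_swap12 spinor_form_rev opprK.
Qed.

Lemma spinor_form_swap23 a b c : w a b c = - w a c b.
Proof. by rewrite spinor_form_cyc spinor_form_rev. Qed.

Hypothesis v1 : dotp v v = 1.

Definition gam_frame : 'M[R]_(8, 7) := \matrix_(i, a) (g a *m v) i 0.
Local Notation E := gam_frame.

Lemma col_gam_frame a : col a E = g a *m v.
Proof. by apply/colP => i; rewrite !mxE. Qed.

Lemma mul_gam_frame (x : 'cV[R]_7) : E *m x = \sum_a x a 0 *: (g a *m v).
Proof.
apply/colP => i; rewrite mxE summxE; apply: eq_bigr => a _.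
by rewrite !mxE mulrC.
Qed.

Lemma gam_frame_orth : E^T *m E = 1%:M.
Proof.
apply/matrixP => a b; rewrite !mxE; have := dotp_gamM a b v.
rewrite v1 mulr1 => <-; rewrite dotpE; apply: eq_bigr => i _.
by rewrite !mxE.
Qed.

Lemma gam_frame_perp : E^T *m v = 0.
Proof.
apply/colP => a; rewrite mxE [RHS]mxE -[RHS](dotp_gam0 a v) dotpE.
by apply: eq_bigr => i _; rewrite !mxE.
Qed.

Lemma gam_frame_perpT : v^T *m E = 0.
Proof. by rewrite -[v^T *m E]trmxK trmx_mul trmxK gam_frame_perp trmx0. Qed.

Lemma vTv : v^T *m v = 1%:M.
Proof. by apply/matrixP => i j; rewrite !ord1 -/(dotp v v) v1 mxE eqxx. Qed.

(** The columns of the square matrix [v E], of size 8 = 1 + 7, are orthonormal, so its transpose is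
    also a right inverse. *)
Lemma gam_frame_complete : v *m v^T + E *m E^T = 1%:M.
Proof.
rewrite -(mul_row_col v E v^T E^T).
apply: (@mulmx1C _ 8 (col_mx v^T E^T : 'M[R]_(1 + 7, 8)) (row_mx v E)).
rewrite [LHS](mul_col_row v^T E^T v E).
by rewrite vTv gam_frame_perpT gam_frame_perp gam_frame_orth -scalar_mx_block.
Qed.

Lemma spinor_expand (u : 'cV[R]_8) :
  u = dotp u v *: v + \sum_a dotp u (g a *m v) *: (g a *m v).
Proof.
rewrite -[LHS]mul1mx -gam_frame_complete mulmxDl -!mulmxA; congr (_ + _).
  by rewrite dotpC [v^T *m u]mx11_scalar mul_mx_scalar.
rewrite mul_gam_frame; apply: eq_bigr => a _; congr (_ *: _).
rewrite !mxE dotpC dotpE; apply: eq_bigr => i _; by rewrite !mxE.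
Qed.

Lemma eq_mx_spinor (X Y : 'M[R]_8) :
  X *m v = Y *m v -> (forall a, X *m (g a *m v) = Y *m (g a *m v)) -> X = Y.
Proof.
move=> e0 e1; have eE : X *m E = Y *m E.
  apply/matrixP => i a.
  have <- : (col a (X *m E)) i 0 = (X *m E) i a by rewrite mxE.
  have <- : (col a (Y *m E)) i 0 = (Y *m E) i a by rewrite mxE.
  by rewrite !colE -(mulmxA X) -(mulmxA Y) -(colE a E) col_gam_frame e1.
by rewrite -[X]mulmx1 -[Y]mulmx1 -gam_frame_complete !mulmxDr !mulmxA e0 eE.
Qed.

(** Coordinates in the orthonormal basis v, e_c v. Up to sign, [w] gives the structure constants of
    the seven-dimensional cross product; the contraction identities below all come from this
    formula. *)
Lemma gam_gam_spinor a b :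
  g a *m (g b *m v) = - (a == b)%:R *: v - \sum_c w a b c *: (g c *m v).
Proof.
rewrite [LHS]spinor_expand; congr (_ + _).
  by rewrite dotp_gam [dotp _ (_ *m v)]dotp_gamM v1 mulr1 eq_sym.
rewrite -sumrN; apply: eq_bigr => c _.
rewrite -scaleNr dotpC dotp_gam; congr (- _ *: _).
by rewrite dotpC -[LHS]/(w c a b) spinor_form_cyc.
Qed.

(** Two evaluations of <e_a e_b v, e_d e_b v>: directly by [dotp_gamM], and after expanding e_a e_b
    v by [gam_gam_spinor]. *)
Lemma spinor_form_contract1 a b d :
  \sum_c w a b c * w d b c = (a == d)%:R - (a == b)%:R * (d == b)%:R.
Proof.
have e := dotp_gamM a d (g b *m v).
rewrite (dotp_gamM b b) eqxx v1 !mulr1 (gam_gam_spinor a b) dotpDl dotpZl in e.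
rewrite dotpNl dotp_suml [dotp v _]dotpC dotp_gam dotp_gamM v1 mulr1 [b == d]eq_sym in e.
rewrite -e.
have -> : \sum_i dotp (w a b i *: (g i *m v)) (g d *m (g b *m v))
   = - \sum_c w a b c * w d b c.
  rewrite -sumrN; apply: eq_bigr => c _; rewrite dotpZl dotpC dotp_gam.
  rewrite dotpC -mulrN; congr (_ * _).
  by rewrite dotpC dotp_gam dotpC opprK -spinor_form_swap12.
by ring.
Qed.

Lemma spinor_form_contract2 a d :
  \sum_b \sum_c w a b c * w d b c = 6 * (a == d)%:R.
Proof.
under eq_bigr do rewrite spinor_form_contract1.
rewrite big_split /= sumr_const card_ord sumrN (bigD1 a) //= big1 ?addr0 => [|b ba].
  by rewrite eqxx mul1r eq_sym -mulr_natl; ring.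
by rewrite [a == b]eq_sym (negbTE ba) mul0r.
Qed.

(** The Clifford action of the two-form e_m _| w, with each pair of indices counted in both
    orders. *)
Definition spinor_form_slice m : 'M[R]_8 :=
  \sum_b \sum_c w m b c *: (g b *m g c).
Local Notation W := spinor_form_slice.

Lemma slice_spinor m : W m *m v = - 6 *: (g m *m v).
Proof.
rewrite mulmx_suml.
under eq_bigr => b _ do rewrite mulmx_suml.
under eq_bigr => b _ do under eq_bigr => c _ do
  rewrite -scalemxAl -mulmxA gam_gam_spinor scalerBr scalerA.
under eq_bigr => b _ do rewrite big_split /= sumrN.
(* The scalar parts sit on the diagonal b = c, where w vanishes; the rest is the double contraction,
   which supplies the 6. *)
rewrite big_split /= sumrN [X in X - _]big1 ?sub0r => [|b _]; last first.
  rewrite big1 // => c _; case: eqP => [->|_]; last by rewrite oppr0 mulr0 scale0r.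
  by have := spinor_form_swap23 m c c => h; rewrite (_ : w m c c = 0) ?mul0r ?scale0r //; lra.
rewrite scaleNr; congr (- _).
under eq_bigr => b _ do under eq_bigr => c _ do rewrite scaler_sumr.
under eq_bigr => b _ do under eq_bigr => c _ do under eq_bigr => e _ do
  rewrite scalerA [w b c e]spinor_form_cyc [w c e b]spinor_form_cyc.
under eq_bigr => b _ do rewrite exchange_big /=.
rewrite exchange_big /=.
under eq_bigr => e _ do under eq_bigr => b _ do rewrite -scaler_suml.
under eq_bigr => e _ do rewrite -scaler_suml.
rewrite (bigD1 m) //= [X in _ + X]big1 ?addr0 => [|e em].
  by rewrite spinor_form_contract2 eqxx mulr1.
by rewrite spinor_form_contract2 eq_sym (negbTE em) mulr0 scale0r.
Qed.

Lemma gam_mul3 b c d :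
  g b *m g c *m g d = g d *m (g b *m g c) + (2 * (b == d)%:R) *: g c
                      - (2 * (c == d)%:R) *: g b.
Proof.
rewrite -mulmxA [g c *m g d]gamC mulmxBr mulmxN (mulmxA (g b) (g d)) [g b *m g d]gamC.
rewrite mulmxBl mulNmx -(mulmxA (g d)) opprB opprK mul_scalar_mx mul_mx_scalar.
by rewrite [X in X - _]addrC.
Qed.

Lemma slice_gam_spinor m d :
  W m *m (g d *m v) = (8 * (m == d)%:R) *: v + 2 *: (g m *m (g d *m v)).
Proof.
(* Moving g d past both gammas leaves two contractions with factor 2, and they are equal by skewness
   of w: hence the 4. *)
have e : W m *m g d = g d *m W m + 4 *: \sum_c w m d c *: g c.
  rewrite mulmx_suml mulmx_sumr.
  under eq_bigr => b _ do rewrite mulmx_suml.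
  under [X in _ = X + _]eq_bigr => b _ do rewrite mulmx_sumr.
  under eq_bigr => b _ do under eq_bigr => c _ do
    rewrite -scalemxAl gam_mul3 scalerBr scalerDr !scalerA scalemxAr.
  under eq_bigr => b _ do rewrite big_split /= sumrN big_split /=.
  rewrite big_split /= sumrN big_split /= -addrA; congr (_ + _).
  rewrite (bigD1 d) //= [X in _ + X - _]big1 ?addr0 => [|b bd]; last first.
    by rewrite big1 // => c _; rewrite (negbTE bd) !mulr0 scale0r.
  rewrite [X in _ - X]exchange_big [X in _ - X](bigD1 d) //= [X in _ - (_ + X)]big1 ?addr0 => [|c cd]; last first.
    by rewrite big1 // => b _; rewrite (negbTE cd) !mulr0 scale0r.
  rewrite eqxx mulr1 -sumrN -big_split /= scaler_sumr; apply: eq_bigr => c _.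
  rewrite [w m c d]spinor_form_swap23 -scaleNr -scalerDl scalerA; congr (_ *: _); ring.
rewrite mulmxA e mulmxDl -mulmxA slice_spinor -scalemxAr.
rewrite !gam_gam_spinor -scalemxAl mulmx_suml.
under [\sum_c _ *m v]eq_bigr => c _ do rewrite -scalemxAl.
under [in X in - 6 *: X]eq_bigr => c _ do rewrite spinor_form_swap12 scaleNr.
rewrite sumrN opprK [d == m]eq_sym !scalerDr !scalerN !scalerA.
set S := \sum_c _; set x := _%:R.
apply/matrixP => i j; rewrite !mxE; ring.
Qed.

(** The slice is 2 e_m plus a multiple of the infinitesimal rotation in the plane of v and e_m v.
    Both sides are compared on the basis v, e_d v. *)
Lemma sliceE m :
  W m = 2 *: g m + 8 *: (v *m (g m *m v)^T - g m *m v *m v^T).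
Proof.
apply: eq_mx_spinor => [|d].
  rewrite slice_spinor mulmxDl -!scalemxAl mulmxBl -!mulmxA vTv mulmx1.
  rewrite [(g m *m v)^T *m v]mx11_scalar -/(dotp (g m *m v) v) dotp_gam0.
  rewrite raddf0 mulmx0 sub0r scalerN -scaleNr -scalerDl; congr (_ *: _); ring.
rewrite slice_gam_spinor mulmxDl -!scalemxAl mulmxBl -!mulmxA addrC; congr (_ + _).
rewrite [(g m *m v)^T *m _]mx11_scalar -/(dotp (g m *m v) (g d *m v)) dotp_gamM v1.
rewrite [v^T *m _]mx11_scalar -/(dotp v (g d *m v)) dotpC dotp_gam0.
by rewrite raddf0 !mulmx0 subr0 mulr1 mul_mx_scalar scalerA.
Qed.

(** * The Clifford action of i(h) *)

Definition sym_clifford (h : 'M[R]_7) : 'M[R]_8 :=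
  \sum_a \sum_m h a m *: (g a *m W m).

(** A symmetric h sees only the symmetric part of e_a e_m, which is the scalar - delta_am. *)
Lemma sum_sym_gam (h : 'M[R]_7) : h^T = h ->
  \sum_a \sum_m h a m *: (g a *m g m) = - (\tr h)%:M.
Proof.
move=> hs; set S := LHS.
have hE a m : h a m = h m a by rewrite -[in LHS]hs mxE.
have SE : S = \sum_a \sum_m h a m *: (g m *m g a).
  by rewrite /S exchange_big; apply: eq_bigr => a _; apply: eq_bigr => m _; rewrite hE.
have : S + S = \sum_a \sum_m (h a m * - (2 * (a == m)%:R))%:M.
  rewrite {2}SE -big_split; apply: eq_bigr => a _ /=; rewrite -big_split.
  apply: eq_bigr => m _ /=; rewrite -scalerDr gam_rel.
  by rewrite -[RHS]scalemx1 -scalerA scalemx1.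
have -> : \sum_a \sum_m (h a m * - (2 * (a == m)%:R))%:M = - (2 * \tr h)%:M :> 'M[R]_8.
  rewrite /mxtrace mulr_sumr -raddfN -sumrN raddf_sum; apply: eq_bigr => a _.
  rewrite (bigD1 a) //= big1 => [|m ma].
    by rewrite addr0 eqxx mulr1; congr (_%:M); ring.
  by rewrite eq_sym (negbTE ma) mulr0 oppr0 mulr0 raddf0.
move=> e; apply/matrixP => i j; move/matrixP/(_ i j): e; rewrite !mxE.
by case: eqP => _ h'; move: h'; rewrite ?mulr1n ?mulr0n; lra.
Qed.

(** Insert [sliceE]: the summand 2 e_m and the one ending in v^T become traces by [sum_sym_gam], and
    the summand v (e_m v)^T builds E h E^T. *)
Lemma sym_cliffordE (h : 'M[R]_7) : h^T = h ->
  sym_clifford h = - (2 * \tr h)%:M + (8 * \tr h) *: (v *m v^T) + 8 *: (E *m h *m E^T).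
Proof.
move=> hs; rewrite /sym_clifford.
under eq_bigr => a _ do under eq_bigr => m _ do
  rewrite sliceE mulmxDr -!scalemxAr mulmxBr !mulmxA scalerDr !scalerA ![h a m * _]mulrC -!scalerA scalerBr.
under eq_bigr => a _ do rewrite big_split /= -!scaler_sumr big_split /= sumrN.
rewrite big_split /= -!scaler_sumr big_split /= sumrN sum_sym_gam //.
have -> : \sum_a \sum_m h a m *: (g a *m v *m (g m *m v)^T) = E *m h *m E^T.
  apply/matrixP => i j; rewrite exchange_big summxE mxE; apply: eq_bigr => m _.
  rewrite !mxE summxE mulr_suml; apply: eq_bigr => a _.
  by rewrite !mxE big_ord1 !mxE; ring.
have -> : \sum_a \sum_m h a m *: (g a *m g m *m v *m v^T) = - (\tr h *: (v *m v^T)).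
  under eq_bigr => a _ do under eq_bigr => m _ do rewrite 2!scalemxAl.
  under eq_bigr => a _ do rewrite -!mulmx_suml.
  by rewrite -!mulmx_suml sum_sym_gam // !mulNmx mul_scalar_mx scalemxAl.
apply/matrixP => i j; rewrite !mxE; case: eqP => _; rewrite ?mulr1n ?mulr0n; ring.
Qed.

(** The sum runs over all ordered triples, so on a skew form it is six times the usual Clifford
    action. *)
Definition clifford_form (T : form3 R) : 'M[R]_8 :=
  \sum_a \sum_b \sum_c T a b c *: (g a *m g b *m g c).

(** [i_op] in an orthonormal frame, where raising an index changes nothing. *)
Definition sym_action (h : 'M[R]_7) : form3 R :=
  skew3 (fun a b c => \sum_j h a j * w j b c).

(** This and the next two lemmas kill the remainders that [gam_mul3] leaves when a gamma is moved
    past the two others. *)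
Lemma sum_contract_last (T : form3 R) (F : 'I_7 -> 'M[R]_8) :
  (forall b, \sum_a T a b a = 0) ->
  \sum_a \sum_b \sum_c (T a b c * (2 * (a == c)%:R)) *: F b = 0.
Proof.
move=> T0; rewrite exchange_big big1 // => b _ /=.
under eq_bigr => a _ do rewrite -scaler_suml.
rewrite -scaler_suml (_ : \sum_i _ = 0) ?scale0r //.
rewrite -[RHS](mulr0 2) -[in RHS](T0 b) mulr_sumr; apply: eq_bigr => a _.
rewrite (bigD1 a) //= big1 => [|c ca]; first by rewrite eqxx mulr1; ring.
by rewrite eq_sym (negbTE ca) !mulr0.
Qed.

Lemma sum_contract_12 (T : form3 R) (F : 'I_7 -> 'M[R]_8) :
  (forall c, \sum_a T a a c = 0) ->
  \sum_a \sum_b \sum_c (T a b c * (2 * (b == a)%:R)) *: F c = 0.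
Proof.
move=> T0; rewrite -[RHS](@sum_contract_last (fun a b c => T a c b) F) //.
apply: eq_bigr => a _; rewrite exchange_big; apply: eq_bigr => b _.
by apply: eq_bigr => c _; rewrite eq_sym.
Qed.

Lemma sum_contract_23 (T : form3 R) (F : 'I_7 -> 'M[R]_8) :
  (forall a b, T a b b = 0) ->
  \sum_a \sum_b \sum_c (T a b c * (2 * (b == c)%:R)) *: F a = 0.
Proof.
move=> T0; do 3 (apply: big1 => ? _).
by case: eqP => [->|_]; rewrite ?T0 ?mul0r ?mulr0 scale0r.
Qed.

(** Meant for T = h_aj w_jbc, which is skew in its last two indices only. As its contractions
    vanish, rotating the three gammas changes nothing, so the cyclic sum in i(h) can be replaced by
    three copies of T. *)
Lemma clifford_form_cyc (T : form3 R) :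
  (forall a b c, T a b c = - T a c b) -> (forall b, \sum_a T a b a = 0) ->
  clifford_form (fun a b c => T b c a) = clifford_form T /\
  clifford_form (fun a b c => T c a b) = clifford_form T.
Proof.
move=> Tskew T0.
have Td a b : T a b b = 0 by have h := Tskew a b b; lra.
have T0' c : \sum_a T a a c = 0.
  by under eq_bigr => a _ do rewrite Tskew; rewrite sumrN T0 oppr0.
split.
  have -> : clifford_form (fun a b c => T b c a)
          = \sum_a \sum_b \sum_c T a b c *: (g c *m g a *m g b).
    by rewrite /clifford_form exchange_big; apply: eq_bigr => a _; rewrite exchange_big.
  have -> : \sum_a \sum_b \sum_c T a b c *: (g c *m g a *m g b)
     = clifford_form T - \sum_a \sum_b \sum_c (T a b c * (2 * (a == c)%:R)) *: g b
       + \sum_a \sum_b \sum_c (T a b c * (2 * (b == c)%:R)) *: g a.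
    rewrite -sumrB -big_split; apply: eq_bigr => a _.
    rewrite -sumrB -big_split; apply: eq_bigr => b _.
    rewrite -sumrB -big_split; apply: eq_bigr => c _ /=.
    rewrite -!scalerA -scalerBr -scalerDr [in RHS]gam_mul3; congr (_ *: _).
    by rewrite mulmxA; apply/matrixP => i j; rewrite !mxE; ring.
  by rewrite sum_contract_last // sum_contract_23 // subr0 addr0.
have -> : clifford_form (fun a b c => T c a b)
          = \sum_a \sum_b \sum_c T a b c *: (g b *m g c *m g a).
  rewrite /clifford_form; under eq_bigr do rewrite exchange_big; rewrite exchange_big.
  by apply: eq_bigr => a _.
have -> : \sum_a \sum_b \sum_c T a b c *: (g b *m g c *m g a)
   = clifford_form T + \sum_a \sum_b \sum_c (T a b c * (2 * (b == a)%:R)) *: g c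
     - \sum_a \sum_b \sum_c (T a b c * (2 * (a == c)%:R)) *: g b.
  rewrite -big_split -sumrB; apply: eq_bigr => a _.
  rewrite -big_split -sumrB; apply: eq_bigr => b _.
  rewrite -big_split -sumrB; apply: eq_bigr => c _ /=.
  rewrite -!scalerA -scalerDr -scalerBr gam_mul3; congr (_ *: _).
  by rewrite [c == a]eq_sym mulmxA !scalerA.
by rewrite sum_contract_last // sum_contract_12 // subr0 addr0.
Qed.

Lemma clifford_formE (T U V : form3 R) k :
  clifford_form (fun a b c => k * (T a b c + U a b c + V a b c))
  = k *: (clifford_form T + clifford_form U + clifford_form V).
Proof.
rewrite /clifford_form -!big_split scaler_sumr; apply: eq_bigr => a _ /=.
rewrite -!big_split scaler_sumr; apply: eq_bigr => b _ /=.
rewrite -!big_split scaler_sumr; apply: eq_bigr => c _ /=.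
by rewrite -!scalerDl scalerA.
Qed.

(** The six terms of [skew3] are equal in pairs because w is skew in its last two indices: 2/6 =
    1/3. *)
Lemma sym_actionE (h : 'M[R]_7) a b c :
  sym_action h a b c = 3^-1 * (\sum_j h a j * w j b c + \sum_j h b j * w j c a
                               + \sum_j h c j * w j a b).
Proof.
rewrite /sym_action /skew3.
have s d e f : \sum_j h d j * w j e f = - \sum_j h d j * w j f e.
  by rewrite -sumrN; apply: eq_bigr => j _; rewrite spinor_form_swap23 mulrN.
rewrite [\sum_j h b j * w j a c]s [\sum_j h a j * w j c b]s [\sum_j h c j * w j b a]s.
by field.
Qed.

Lemma clifford_sym_action (h : 'M[R]_7) : h^T = h ->
  clifford_form (sym_action h) = sym_clifford h.
Proof.
move=> hs; pose T : form3 R := fun a b c => \sum_j h a j * w j b c.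
have Tskew a b c : T a b c = - T a c b.
  by rewrite /T -sumrN; apply: eq_bigr => j _; rewrite spinor_form_swap23 mulrN.
(* This contracts the symmetric h with the skew w. *)
have T0 b : \sum_a T a b a = 0.
  have e : \sum_a T a b a = - \sum_a T a b a.
    rewrite /T [LHS]exchange_big -sumrN; apply: eq_bigr => a _ /=.
    rewrite -sumrN; apply: eq_bigr => j _.
    by rewrite [w a b j]spinor_form_rev mulrN -[in LHS]hs mxE.
  lra.
have [e1 e2] := clifford_form_cyc Tskew T0.
have -> : sym_action h = fun a b c => 3^-1 * (T a b c + T b c a + T c a b).
  by do 3 (apply: funext => ?); rewrite sym_actionE.
rewrite (clifford_formE T (fun a b c => T b c a) (fun a b c => T c a b)) e1 e2.
have -> : 3^-1 *: (clifford_form T + clifford_form T + clifford_form T) = clifford_form T.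
  by move: (clifford_form T) => X; apply/matrixP => i j; rewrite !mxE; field.
apply: eq_bigr => a _; rewrite /spinor_form_slice.
under [RHS]eq_bigr => m _ do rewrite mulmx_sumr scaler_sumr.
rewrite [RHS]exchange_big; apply: eq_bigr => b _.
under [RHS]eq_bigr => m _ do rewrite mulmx_sumr scaler_sumr.
rewrite [RHS]exchange_big; apply: eq_bigr => c _ /=.
by rewrite scaler_suml; apply: eq_bigr => m _; rewrite -scalemxAr scalerA mulmxA.
Qed.

Lemma clifford_spinor_form : clifford_form w = sym_clifford 1%:M.
Proof.
apply: eq_bigr => a _; rewrite [RHS](bigD1 a) //= [X in _ = _ + X]big1 => [|m ma]; last first.
  by rewrite !mxE eq_sym (negbTE ma) scale0r.
rewrite mxE eqxx scale1r addr0 mulmx_sumr; apply: eq_bigr => b _.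
by rewrite mulmx_sumr; apply: eq_bigr => c _; rewrite -scalemxAr mulmxA.
Qed.

(** The entry at v is 6 tr h and recovers the trace; the block on the image of E is then known up to
    8 h. *)
Lemma sym_clifford_inj (h k : 'M[R]_7) : h^T = h -> k^T = k ->
  sym_clifford h = sym_clifford k -> h = k.
Proof.
have vX (l : 'M[R]_7) : l^T = l -> dotp v (sym_clifford l *m v) = 6 * \tr l.
  move=> hs; rewrite sym_cliffordE // !mulmxDl mulNmx mul_scalar_mx -!scalemxAl -!mulmxA.
  rewrite gam_frame_perp !mulmx0 scaler0 addr0 vTv mulmx1 -scaleNr -scalerDl dotpC dotpZl v1.
  by ring.
have EX (l : 'M[R]_7) : l^T = l ->
    E^T *m sym_clifford l *m E = - (2 * \tr l)%:M + 8 *: l.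
  move=> hs; rewrite sym_cliffordE // mulmxDr mulmxDl mulmxDr mulmxDl.
  rewrite -!scalemxAr !mulmxA -!scalemxAl gam_frame_perp !mul0mx scaler0 addr0.
  rewrite gam_frame_orth mul1mx -[l *m E^T *m E]mulmxA gam_frame_orth mulmx1.
  by rewrite mulmxN mulNmx mul_mx_scalar -scalemxAl gam_frame_orth scalemx1.
move=> hs ks e; have t : \tr h = \tr k.
  by have := vX _ hs; rewrite e vX //; lra.
have := EX _ hs; rewrite e EX // t => /addrI /(congr1 (fun X => 8^-1 *: X)).
by rewrite !scalerA mulVf ?pnatr_eq0 // !scale1r.
Qed.

Lemma sym_action_inj (h k : 'M[R]_7) : h^T = h -> k^T = k ->
  sym_action h = sym_action k -> h = k.
Proof.
move=> hs ks e; apply: sym_clifford_inj => //.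
by rewrite -!clifford_sym_action // e.
Qed.

Lemma mxtrace_sym_skew n (X Y : 'M[R]_n) : X^T = X -> Y^T = - Y -> \tr (X *m Y) = 0.
Proof.
move=> Xs Ys; have : \tr (X *m Y) = - \tr (X *m Y).
  by rewrite -{1}mxtrace_tr trmx_mul Xs Ys mulNmx raddfN mxtrace_mulC.
lra.
Qed.

Lemma gam_frame_gam x a b : (E^T *m g x *m E) a b = w x a b.
Proof.
have -> : (E^T *m g x *m E) a b = dotp (col a E) (g x *m col b E).
  rewrite -mulmxA mxE dotpE; apply: eq_bigr => i _; rewrite !mxE; congr (_ * _).
  by apply: eq_bigr => j _; rewrite !mxE.
rewrite !col_gam_frame dotpC -[LHS]opprK -[X in - X]dotp_gam.
by rewrite [RHS]spinor_form_swap12.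
Qed.

(** Since v is orthogonal to the image of E, the product is a symmetric matrix plus 64 E h k E^T.
    The symmetric part has trace zero against the skew g x. *)
Lemma mxtrace_sym_clifford (h k : 'M[R]_7) x : h^T = h -> k^T = k ->
  \tr (sym_clifford h *m sym_clifford k *m g x) = 64 * \tr (h *m k *m (E^T *m g x *m E)).
Proof.
move=> hs ks.
set P := v *m v^T; set X := E *m h *m E^T; set Y := E *m k *m E^T.
have Ps : P^T = P by rewrite trmx_mul trmxK.
have Xs : X^T = X by rewrite !trmx_mul trmxK hs mulmxA.
have Ys : Y^T = Y by rewrite !trmx_mul trmxK ks mulmxA.
have PP : P *m P = P by rewrite /P mulmxA -(mulmxA v) vTv mulmx1.
have PY : P *m Y = 0 by rewrite /P /Y !mulmxA -(mulmxA v) gam_frame_perpT mulmx0 !mul0mx.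
have XP : X *m P = 0 by rewrite /P /X !mulmxA -(mulmxA _ E^T) gam_frame_perp mulmx0 mul0mx.
have XY : X *m Y = E *m (h *m k) *m E^T.
  by rewrite /X /Y !mulmxA -(mulmxA _ E^T E) gam_frame_orth mulmx1.
rewrite !sym_cliffordE // -/P -/X -/Y.
set s := \tr h; set t := \tr k.
have -> : (- (2 * s)%:M + (8 * s) *: P + 8 *: X) *m (- (2 * t)%:M + (8 * t) *: P + 8 *: Y)
  = ((4 * s * t)%:M + (32 * s * t) *: P + (- 16 * s) *: Y + (- 16 * t) *: X)
    + 64 *: (E *m (h *m k) *m E^T).
  rewrite -XY !mulmxDl !mulmxDr !(mulNmx, mulmxN) !opprK.
  rewrite !mul_scalar_mx !mul_mx_scalar -!scalemxAl -!scalemxAr PP PY XP !scaler0.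
  by apply/matrixP => i j; rewrite !mxE; case: eqP => _; rewrite ?mulr1n ?mulr0n; ring.
rewrite mulmxDl raddfD /= mxtrace_sym_skew ?add0r.
- by rewrite -scalemxAl linearZ /= -!mulmxA mxtrace_mulC !mulmxA.
- by rewrite !linearD /= !linearZ /= tr_scalar_mx Ps Xs Ys.
- exact: gam_skew.
Qed.

Lemma mxtrace_outer n (u u' : 'cV[R]_n) : \tr (u *m u'^T) = dotp u' u.
Proof. by rewrite mxtrace_mulC /mxtrace big_ord1. Qed.

Lemma mxtrace_gam_gam m n : \tr (g m *m g n) = - (8 * (m == n)%:R).
Proof.
have := congr1 mxtrace (gam_rel C m n).
rewrite raddfD /= [\tr (g n *m _)]mxtrace_mulC mxtrace_scalar => h.
by rewrite -mulr_natl in h; lra.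
Qed.

Lemma sym_clifford1 : sym_clifford 1%:M = 48 *: (v *m v^T) - 6%:M.
Proof.
rewrite sym_cliffordE ?trmx1 // mulmx1 mxtrace1.
have -> : E *m E^T = 1%:M - v *m v^T by rewrite -gam_frame_complete addrC addKr.
by apply/matrixP => i j; rewrite !mxE; case: eqP => _; rewrite ?mulr1n ?mulr0n; ring.
Qed.

(** This will be the Bryant form of w. By [sym_clifford1] the trace is 48 <W_m W_n v, v> - 6 tr(W_m
    W_n), and 48 (-36) - 6 (-96) = -1152. *)
Lemma mxtrace_slice m n :
  \tr (W m *m W n *m sym_clifford 1%:M) = - (1152 * (m == n)%:R).
Proof.
set d := (m == n)%:R.
have mvn : dotp (g m *m v) (g n *m v) = d by rewrite dotp_gamM v1 mulr1.
have nvm : dotp (g n *m v) (g m *m v) = d by rewrite dotpC.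
have vgg : dotp v (g n *m (g m *m v)) = - d.
  by rewrite -mvn [in RHS]dotpC dotp_gam opprK.
have vgg' : dotp v (g m *m (g n *m v)) = - d.
  by rewrite -mvn dotp_gam opprK.
have tvv : \tr (W m *m W n *m (v *m v^T)) = - (36 * d).
  rewrite mulmxA mxtrace_outer -mulmxA slice_spinor -scalemxAr slice_gam_spinor.
  by rewrite dotpC dotpZl dotpDl !dotpZl v1 dotpC vgg' -/d; ring.
have tWW : \tr (W m *m W n) = - (96 * d).
  rewrite !sliceE; set a := g m *m v; set b := g n *m v.
  have -> : (2 *: g m + 8 *: (v *m a^T - a *m v^T)) *m (2 *: g n + 8 *: (v *m b^T - b *m v^T))
    = 4 *: (g m *m g n) + 16 *: ((g m *m v) *m b^T - (g m *m b) *m v^T)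
      + 16 *: (v *m (a^T *m g n) - a *m (v^T *m g n))
      + 64 *: (v *m (a^T *m v *m b^T) - v *m (a^T *m b *m v^T)
               - a *m (v^T *m v *m b^T) + a *m (v^T *m b *m v^T)).
    rewrite !(mulmxDl, mulmxDr, mulNmx, mulmxN, =^~ scalemxAl, =^~ scalemxAr) !mulmxA.
    by apply/matrixP => i j; rewrite !mxE; ring.
  have tN (X : 'M[R]_8) : \tr (- X) = - \tr X by rewrite raddfN.
  rewrite !(mxtraceD, tN, mxtraceZ) mxtrace_gam_gam -/d.
  have c1 (x y : 'cV[R]_8) : x^T *m y = (dotp x y)%:M by exact: mx11_scalar.
  have gT k (x : 'cV[R]_8) : x^T *m g k = - (g k *m x)^T.
    by rewrite trmx_mul gam_skew mulmxN opprK.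
  rewrite !gT !c1 !mulmxN !tN !mul_scalar_mx -!scalemxAr !mxtraceZ !mxtrace_outer.
  rewrite v1 [dotp a v]dotp_gam0 [dotp v b]dotpC [dotp b v]dotp_gam0 -/a.
  rewrite vgg' nvm mvn [dotp (g n *m a) v]dotpC vgg.
  ring.
rewrite sym_clifford1 mulmxBr raddfB /= -scalemxAr mxtraceZ tvv mul_mx_scalar mxtraceZ tWW.
ring.
Qed.

End UnitSpinor.

(** * Traces of seven Clifford factors, determinants, and covariance of the wedge and Bryant
    forms *)

Section CliffordTrace.
Context (R : realType) (C : clifford_module R).
Local Notation g := (gam C).
Local Notation gprod f := (\prod_(k < 7) g (f k)).

Lemma gam_anticomm a b : a != b -> g a * g b = - (g b * g a).
Proof. by move=> /negbTE ab; rewrite -!mulmxE gamC ab mulr0 raddf0 subr0. Qed.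

Lemma gam_prod_anticomm n (f : 'I_n -> 'I_7) j : (forall k, f k != j) ->
  g j * \prod_(k < n) g (f k) = (- 1) ^+ n * (\prod_(k < n) g (f k) * g j).
Proof.
elim: n f => [|n IH] f fj; first by rewrite !big_ord0 mulr1 !mul1r.
rewrite !big_ord_recl mulrA gam_anticomm; last by rewrite eq_sym.
have e := IH (fun k => f (lift ord0 k)) (fun k => fj _).
rewrite mulNr -!mulrA e exprS mulN1r mulNr.
by congr (- _); rewrite -signr_odd; case: (odd n); rewrite ?expr1 ?expr0 !(mulN1r, mul1r, mulrN).
Qed.

(** When the index j is absent, g j anticommutes with the product, whose length 7 is odd;
    conjugation by g j then shows the trace to equal its negative. *)
Lemma mxtrace_gam_prod0 (f : 'I_7 -> 'I_7) j : (forall k, f k != j) -> \tr (gprod f) = 0.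
Proof.
move=> fj; have := gam_prod_anticomm fj; rewrite -signr_odd expr1 mulN1r.
set P := \prod_k _ => e.
have : \tr (g j *m P *m g j) = \tr (g j *m P *m g j) by [].
rewrite {1}[_ *m P]e mulNmx -[P * g j *m g j]mulmxA gam_sq mulmxN mulmx1 opprK.
rewrite mxtrace_mulC mulmxA gam_sq mulNmx mul1mx raddfN /=.
lra.
Qed.

Lemma gam_prod7 (f : 'I_7 -> 'I_7) :
  gprod f = g (f (@Ordinal 7 0 isT)) * g (f (@Ordinal 7 1 isT)) * g (f (@Ordinal 7 2 isT)) *
   g (f (@Ordinal 7 3 isT)) * g (f (@Ordinal 7 4 isT)) * g (f (@Ordinal 7 5 isT)) *
   g (f (@Ordinal 7 6 isT)).
Proof.
rewrite !big_ord_recl big_ord0 mulr1 !mulrA.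
by do !congr (_ * _); congr (g (f _)); apply: val_inj.
Qed.

Definition swap_odd (t : 'S_7) := forall s : 'S_7, gprod (t * s)%g = - gprod s.

Lemma swap_odd_adj (i j : 'I_7) : j = i.+1 :> nat -> swap_odd (tperm i j).
Proof.
move=> ij s; rewrite !gam_prod7 !permM.
have ac : g (s j) * g (s i) = - (g (s i) * g (s j)).
  apply: gam_anticomm; apply: contra_neq (_ : j != i) => [/perm_inj //|].
  by rewrite -val_eqE /= ij gtn_eqF.
have acl X : X * g (s j) * g (s i) = - (X * g (s i) * g (s j)).
  by rewrite -mulrA ac mulrN mulrA.
move: ac acl; case: i ij => i ilt; case: j => j jlt /= ij; subst j.
move: ilt jlt; case: i => [|[|[|[|[|[|//]]]]]] ilt jlt;
  rewrite (bool_irrelevance ilt isT) (bool_irrelevance jlt isT) => ac acl;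
  by rewrite !permE /= (ac, acl) ?mulNr.
Qed.

(** An adjacent swap is a single anticommutation. A longer one is the conjugate of a shorter one by
    an adjacent swap, so three signs accumulate. *)
Lemma swap_odd_tperm (i j : 'I_7) : (i < j)%N -> swap_odd (tperm i j).
Proof.
have [n] := ubnP (j - i)%N; elim: n i => // n IH i; rewrite ltnS => jin ij.
have i7 : (i.+1 < 7)%N by apply: leq_ltn_trans ij _.
have [ji|ji] := eqVneq (val j) i.+1; first exact: swap_odd_adj.
pose k := Ordinal i7.
have ki : swap_odd (tperm i k) by apply: swap_odd_adj.
have kj : swap_odd (tperm k j).
  have kj : (k < j)%N by rewrite /= ltn_neqAle eq_sym ji.
  by apply: IH => //=; rewrite subnS -ltnS prednK ?subn_gt0.
have -> : tperm i j = (tperm i k * tperm k j * tperm i k)%g.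
  have -> : (tperm i k * tperm k j * tperm i k)%g = (tperm k j ^ tperm i k)%g.
    by rewrite conjgE tpermV mulgA.
  have ij' : i != j by rewrite -val_eqE ltn_eqF.
  have kj' : k != j by rewrite -val_eqE /= eq_sym.
  by rewrite tpermJ tpermR tpermD.
by move=> s; rewrite -!mulgA ki kj ki opprK.
Qed.

Lemma gam_prod_perm (s : 'S_7) : gprod s = (- 1) ^+ s * gprod (1%g : 'S_7).
Proof.
have sw (i j : 'I_7) : i != j -> swap_odd (tperm i j).
  rewrite -val_eqE neq_ltn => /orP[|]; first exact: swap_odd_tperm.
  by rewrite tpermC; exact: swap_odd_tperm.
case: (prod_tpermP s) => ts -> {s}; elim: ts => [|t ts IH] /=.
  by rewrite big_nil odd_perm1 mul1r.
case/andP=> t12 dts; rewrite big_cons (sw _ _ t12) IH // odd_permM odd_tperm t12.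
by rewrite addTb signrN mulNr.
Qed.

(** The trace of the volume element: 8 or -8 according to which of the two Clifford modules [C] is,
    hence kept as a symbol. *)
Definition volume_trace : R := \tr (gprod (1%g : 'S_7)).

(** The Leibniz expansion: a non-injective choice of indices misses some index and has trace zero,
    and permutations contribute their signs. *)
Lemma mxtrace_cliff_prod (N : 'M[R]_7) :
  \tr (\prod_(k < 7) \sum_i N k i *: g i) = volume_trace * \det N.
Proof.
pose F := {ffun 'I_7 -> 'I_7}.
rewrite bigA_distr_bigA /= raddf_sum /=.
transitivity (\sum_(f : F) \prod_(k < 7) N k (f k) * \tr (gprod f)).
  by apply: eq_bigr => f _; rewrite scaler_prod linearZ.
rewrite (bigID (fun f : F => injectiveb f)) /= addrC big1 ?add0r => [|f Uf]; last first.
  have [j jP] : exists j, forall k, f k != j.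
    apply: contrapT => H; case/negP: Uf; apply/injectiveP.
    have fs j : exists k, f k == j.
      by apply: contrapT => H'; apply: H; exists j => k; apply/negP => fk; apply: H'; exists k.
    have hK : cancel (fun j => xchoose (fs j)) f by move=> j; apply/eqP/(xchooseP (fs j)).
    exact: can_inj (canF_sym hK).
  by rewrite (mxtrace_gam_prod0 jP) mulr0.
rewrite (reindex (@pval _)) /=; last first.
  pose in_Sn := insubd (1%g : 'S_7).
  by exists in_Sn => /= f Uf; first apply: val_inj; apply: insubdK.
rewrite mulr_sumr; apply: eq_big => /= [s | s _]; rewrite ?(valP s) //.
transitivity (\prod_k N k (s k) * \tr (gprod s)).
  by rewrite pvalE.
rewrite gam_prod_perm.
have -> : \tr ((- 1) ^+ s * gprod (1%g : 'S_7)) = (- 1) ^+ s * volume_trace.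
  by case: (odd_perm s); rewrite ?expr1 ?expr0 ?mulN1r ?mul1r ?raddfN.
by rewrite mulrCA [RHS]mulrC mulrA.
Qed.

(** Pulling a form back along A amounts to keeping its coefficients and putting these matrices in
    place of the gammas. *)
Definition gam_pull (A : 'M[R]_7) a : 'M[R]_8 := \sum_i A a i *: g i.

Lemma gam_pull1 a : gam_pull 1%:M a = g a.
Proof.
rewrite /gam_pull (bigD1 a) //= mxE eqxx scale1r big1 ?addr0 // => i ia.
by rewrite mxE eq_sym (negbTE ia) scale0r.
Qed.

(** Repeated indices are allowed: both traces are [volume_trace] times a determinant, of the
    selected rows of A on the left and of the selected rows of the identity on the right. *)
Lemma mxtrace_gam_pull (A : 'M[R]_7) a b c d e f h (G := gam_pull A) :
  \tr (G a *m G b *m G c *m (G d *m G e *m G f *m G h)) =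
  \det A * \tr (g a *m g b *m g c *m (g d *m g e *m g f *m g h)).
Proof.
pose s k := nth a [:: a; b; c; d; e; f; h] k.
have tr_prod (F : 'I_7 -> 'M[R]_8) :
    \tr (F a *m F b *m F c *m (F d *m F e *m F f *m F h)) = \tr (\prod_(k < 7) F (s k)).
  by rewrite !big_ord_recl big_ord0 mulr1 -!mulmxE !mulmxA.
have tr_pull (B : 'M[R]_7) :
    \tr (\prod_(k < 7) gam_pull B (s k)) = volume_trace * (\det (rowsub (s \o val) 1%:M) * \det B).
  rewrite -det_mulmx mul_rowsub_mx mul1mx -mxtrace_cliff_prod; congr (\tr _).
  by apply: eq_bigr => k _; apply: eq_bigr => i _; rewrite mxE.
rewrite /G !tr_prod tr_pull.
have := tr_pull 1%:M; rewrite (eq_bigr (fun k : 'I_7 => g (s k))) => [->|k _]; last exact: gam_pull1.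
by rewrite det1; ring.
Qed.

Lemma mxtrace_sum3 (T : form3 R) (X : 'I_7 -> 'I_7 -> 'I_7 -> 'M[R]_8) Y :
  \tr ((\sum_a \sum_b \sum_c T a b c *: X a b c) *m Y) =
  \sum_a \sum_b \sum_c T a b c * \tr (X a b c *m Y).
Proof.
rewrite mulmx_suml raddf_sum; apply: eq_bigr => a _ /=.
rewrite mulmx_suml raddf_sum; apply: eq_bigr => b _ /=.
rewrite mulmx_suml raddf_sum; apply: eq_bigr => c _ /=.
by rewrite -scalemxAl mxtraceZ.
Qed.

Lemma mxtrace_sum1 (x : 'I_7 -> R) (X : 'I_7 -> 'M[R]_8) Y :
  \tr ((\sum_a x a *: X a) *m Y) = \sum_a x a * \tr (X a *m Y).
Proof.
rewrite mulmx_suml raddf_sum; apply: eq_bigr => a _ /=.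
by rewrite -scalemxAl mxtraceZ.
Qed.

Lemma exchange_big4 (V : nmodType) (F : 'I_7 -> 'I_7 -> 'I_7 -> 'I_7 -> V) :
  \sum_i \sum_j \sum_k \sum_a F i j k a = \sum_a \sum_i \sum_j \sum_k F i j k a.
Proof.
under eq_bigr => i _ do under eq_bigr => j _ do rewrite exchange_big.
by under eq_bigr => i _ do rewrite exchange_big; rewrite exchange_big.
Qed.

Lemma clifford_pullback3 (A : 'M[R]_7) (T : form3 R) (G := gam_pull A) :
  clifford_form C (pullback3 A T) = \sum_a \sum_b \sum_c T a b c *: (G a *m G b *m G c).
Proof.
rewrite /clifford_form /pullback3.
under eq_bigr => i _ do under eq_bigr => j _ do under eq_bigr => k _ do
  rewrite scaler_suml.
rewrite exchange_big4; apply: eq_bigr => a _.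
under eq_bigr => i _ do under eq_bigr => j _ do under eq_bigr => k _ do
  rewrite scaler_suml.
rewrite exchange_big4; apply: eq_bigr => b _.
under eq_bigr => i _ do under eq_bigr => j _ do under eq_bigr => k _ do
  rewrite scaler_suml.
rewrite exchange_big4; apply: eq_bigr => c _.
rewrite /G /gam_pull !mulmx_suml scaler_sumr; apply: eq_bigr => i _.
rewrite [X in _ *: (X *m _)]mulmx_sumr mulmx_suml scaler_sumr; apply: eq_bigr => j _.
rewrite mulmx_sumr scaler_sumr; apply: eq_bigr => k _.
rewrite -!scalemxAl -!scalemxAr -!scalemxAl !scalerA; congr (_ *: _); ring.
Qed.

(** On skew forms, the coefficient of [b /\ w /\ x] up to a constant: a trace of an odd
    Clifford element sees only its component of degree 7. *)
Definition wedge_pairing (b w : form3 R) (x : 'I_7 -> R) : R :=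
  \tr (clifford_form C b *m (clifford_form C w *m \sum_i x i *: g i)).

Lemma wedge_pairing_pullback (A : 'M[R]_7) b w (x : 'I_7 -> R) :
  wedge_pairing (pullback3 A b) (pullback3 A w) (fun i => \sum_a x a * A a i) =
  \det A * wedge_pairing b w x.
Proof.
have -> : wedge_pairing (pullback3 A b) (pullback3 A w) (fun i => \sum_a x a * A a i) =
  \tr ((\sum_a0 \sum_b0 \sum_c b a0 b0 c *: (gam_pull A a0 *m gam_pull A b0 *m gam_pull A c))
    *m ((\sum_a0 \sum_b0 \sum_c w a0 b0 c *: (gam_pull A a0 *m gam_pull A b0 *m gam_pull A c))
    *m \sum_a x a *: gam_pull A a)).
  rewrite /wedge_pairing !clifford_pullback3; congr (\tr (_ *m (_ *m _))).
  under eq_bigr => i _ do rewrite scaler_suml.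
  rewrite exchange_big; apply: eq_bigr => a _ /=; rewrite scaler_sumr.
  by apply: eq_bigr => i _; rewrite scalerA.
(* With B free, the same expansion is read at A and at the identity; the two readings differ only in
   det B. *)
have ex (B : 'M[R]_7) (G := gam_pull B) :
  \tr ((\sum_a0 \sum_b0 \sum_c b a0 b0 c *: (G a0 *m G b0 *m G c))
    *m ((\sum_a0 \sum_b0 \sum_c w a0 b0 c *: (G a0 *m G b0 *m G c)) *m \sum_a x a *: G a))
  = \sum_a0 \sum_b0 \sum_c b a0 b0 c * \sum_d \sum_e \sum_f w d e f * \sum_h x h *
     (\det B * \tr (g a0 *m g b0 *m g c *m (g d *m g e *m g f *m g h))).
  rewrite mxtrace_sum3; do 3 (apply: eq_bigr => ? _); congr (_ * _).
  rewrite mxtrace_mulC -[X in \tr X]mulmxA mxtrace_sum3; do 3 (apply: eq_bigr => ? _); congr (_ * _).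
  rewrite mxtrace_mulC -[X in \tr X]mulmxA mxtrace_sum1; apply: eq_bigr => ? _; congr (_ * _).
  by rewrite -mxtrace_gam_pull mxtrace_mulC -[X in \tr X]mulmxA.
rewrite ex; have := ex 1%:M; rewrite det1.
have -> : gam_pull 1%:M = g by apply: funext => a; rewrite gam_pull1.
move=> e; rewrite /wedge_pairing [in RHS]e mulr_sumr; apply: eq_bigr => a _.
rewrite mulr_sumr; apply: eq_bigr => a1 _.
rewrite mulr_sumr; apply: eq_bigr => a2 _.
rewrite mulrCA; congr (_ * _).
rewrite mulr_sumr; apply: eq_bigr => a3 _.
rewrite mulr_sumr; apply: eq_bigr => a4 _.
rewrite mulr_sumr; apply: eq_bigr => a5 _.
rewrite mulrCA; congr (_ * _).
by rewrite mulr_sumr; apply: eq_bigr => a6 _; rewrite mulrCA mul1r.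
Qed.

(** Bryant's [(e_i _| T) /\ (e_j _| T) /\ T], as a trace. *)
Definition bryant_mx (T : form3 R) : 'M[R]_7 :=
  let slice i := \sum_b \sum_c T i b c *: (g b *m g c) in
  \matrix_(i, j) \tr (slice i *m (slice j *m clifford_form C T)).

Lemma mxtrace_sum2 (x : 'I_7 -> 'I_7 -> R) (X : 'I_7 -> 'I_7 -> 'M[R]_8) Y :
  \tr ((\sum_b \sum_c x b c *: X b c) *m Y) = \sum_b \sum_c x b c * \tr (X b c *m Y).
Proof.
rewrite mulmx_suml raddf_sum; apply: eq_bigr => a _ /=.
by rewrite mxtrace_sum1.
Qed.

Lemma slice_pullback3 (A : 'M[R]_7) (T : form3 R) i (G := gam_pull A) :
  \sum_b \sum_c pullback3 A T i b c *: (g b *m g c) =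
  \sum_a A a i *: \sum_b \sum_c T a b c *: (G b *m G c).
Proof.
under eq_bigr => j _ do under eq_bigr => k _ do rewrite scaler_suml.
under eq_bigr => j _ do rewrite exchange_big.
rewrite exchange_big; apply: eq_bigr => a _.
under eq_bigr => j _ do under eq_bigr => k _ do rewrite scaler_suml.
under eq_bigr => j _ do rewrite exchange_big.
rewrite exchange_big scaler_sumr; apply: eq_bigr => b _.
under eq_bigr => j _ do under eq_bigr => k _ do rewrite scaler_suml.
under eq_bigr => j _ do rewrite exchange_big.
rewrite exchange_big scaler_sumr; apply: eq_bigr => c _.
rewrite /G /gam_pull mulmx_suml !scaler_sumr; apply: eq_bigr => j _.
rewrite mulmx_sumr !scaler_sumr; apply: eq_bigr => k _.
rewrite -scalemxAl -scalemxAr !scalerA; congr (_ *: _); ring.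
Qed.

(** The free slots i and j transform by A as in any bilinear form, the seven Clifford factors by det
    A: the values are seven-forms. *)
Lemma bryant_pullback (A : 'M[R]_7) T :
  bryant_mx (pullback3 A T) = \det A *: (A^T *m bryant_mx T *m A).
Proof.
pose sl (B : 'M[R]_7) a := \sum_b \sum_c T a b c *: (gam_pull B b *m gam_pull B c).
pose fm (B : 'M[R]_7) := \sum_a \sum_b \sum_c
  T a b c *: (gam_pull B a *m gam_pull B b *m gam_pull B c).
have ex (B : 'M[R]_7) i j : \tr (sl B i *m (sl B j *m fm B)) =
  \sum_b \sum_c T i b c * \sum_d \sum_e T j d e * \sum_f \sum_h \sum_k T f h k *
    (\det B * \tr (g b *m g c *m g d *m (g e *m g f *m g h *m g k))).
  rewrite mxtrace_sum2; apply: eq_bigr => b _; apply: eq_bigr => c _; congr (_ * _).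
  rewrite mxtrace_mulC -[X in \tr X]mulmxA mxtrace_sum2.
  apply: eq_bigr => d _; apply: eq_bigr => e _; congr (_ * _).
  rewrite mxtrace_mulC -[X in \tr X]mulmxA mxtrace_sum3.
  apply: eq_bigr => f _; apply: eq_bigr => h _; apply: eq_bigr => k _; congr (_ * _).
  by rewrite -mxtrace_gam_pull mxtrace_mulC -!mulmxA.
have exdet i j : \tr (sl A i *m (sl A j *m fm A)) = \det A * bryant_mx T i j.
  have := ex 1%:M i j; rewrite /sl /fm det1.
  have -> : gam_pull 1%:M = g by apply: funext => a; rewrite gam_pull1.
  rewrite mxE => e; rewrite [in RHS]e ex mulr_sumr; apply: eq_bigr => b _.
  rewrite mulr_sumr; apply: eq_bigr => c _; rewrite mulrCA; congr (_ * _).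
  rewrite mulr_sumr; apply: eq_bigr => d _.
  rewrite mulr_sumr; apply: eq_bigr => d1 _; rewrite mulrCA; congr (_ * _).
  rewrite mulr_sumr; apply: eq_bigr => d2 _.
  rewrite mulr_sumr; apply: eq_bigr => d3 _.
  by rewrite mulr_sumr; apply: eq_bigr => d4 _; rewrite mulrCA mul1r.
apply/matrixP => i j; rewrite [LHS]mxE /= !slice_pullback3 clifford_pullback3 -/(fm A).
rewrite mxE mxtrace_sum1 mxE mulr_sumr.
under [RHS]eq_bigr => b _ do rewrite mxE mulr_suml mulr_sumr.
rewrite [RHS]exchange_big; apply: eq_bigr => a _ /=.
rewrite mxtrace_mulC -mulmxA mxtrace_sum1 mulr_sumr; apply: eq_bigr => b _.
by rewrite mxtrace_mulC -mulmxA mxtrace_mulC -mulmxA -/(sl A a) -/(sl A b) exdet [A^T i a]mxE; ring.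
Qed.

End CliffordTrace.

(** * Metric, i(h) and wedge pairing in an arbitrary frame *)

Section PulledBackForms.
Context (R : realType) (C : clifford_module R).
Implicit Types (A B h : 'M[R]_7) (T : form3 R) (v : 'cV[R]_8).

Lemma bryant_spinor_form v : dotp v v = 1 ->
  bryant_mx C (spinor_form C v) = (- 1152)%:M.
Proof.
move=> v1; apply/matrixP => i j; rewrite !mxE mulmxA clifford_spinor_form //.
rewrite -/(spinor_form_slice C v i) -/(spinor_form_slice C v j) mxtrace_slice //.
by case: eqP => _; rewrite ?mulr1n ?mulr0n; ring.
Qed.

(** Bryant forms give det A A^T A = det B B^T B. Determinants of the two sides are the ninth powers
    (7 + 2) of det A and det B, so positivity yields det A = det B. *)
Lemma metric_spinor_form_inj A B v v' : dotp v v = 1 -> dotp v' v' = 1 ->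
  0 < \det A -> 0 < \det B ->
  pullback3 A (spinor_form C v) = pullback3 B (spinor_form C v') ->
  A^T *m A = B^T *m B.
Proof.
move=> v1 v1' A0 B0 /(congr1 (bryant_mx C)).
rewrite !bryant_pullback !bryant_spinor_form // !mul_mx_scalar -!scalemxAl.
rewrite !scalerA ![\det _ * _]mulrC -!scalerA => /scalerI e.
have {}e : \det A *: (A^T *m A) = \det B *: (B^T *m B).
  by apply: e; rewrite oppr_eq0 pnatr_eq0.
have dAB : \det A = \det B.
  have := congr1 determinant e; rewrite !detZ !det_mulmx !det_tr -!expr2 -!exprD.
  by move=> /eqP; rewrite eqrXn2 ?ltW // => /eqP.
by move: e; rewrite dAB => /scalerI; apply; rewrite gt_eqF.
Qed.

Lemma pullback3M A B T : pullback3 B (pullback3 A T) = pullback3 (A *m B) T.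
Proof.
do 3 apply: funext => ?; rewrite /pullback3.
under eq_bigr => p _ do under eq_bigr => q _ do under eq_bigr => r _ do rewrite mulr_sumr.
rewrite exchange_big4; apply: eq_bigr => a _.
under eq_bigr => p _ do under eq_bigr => q _ do under eq_bigr => r _ do rewrite mulr_sumr.
rewrite exchange_big4; apply: eq_bigr => b _.
under eq_bigr => p _ do under eq_bigr => q _ do under eq_bigr => r _ do rewrite mulr_sumr.
rewrite exchange_big4; apply: eq_bigr => c _.
rewrite !mxE !mulr_suml; apply: eq_bigr => p _; rewrite [LHS]exchange_big.
rewrite mulr_sumr !mulr_suml; apply: eq_bigr => q _.
rewrite mulr_sumr !mulr_suml; apply: eq_bigr => r _.
by ring.
Qed.

Lemma pullback3_1 T : pullback3 1%:M T = T.
Proof.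
do 3 apply: funext => ?; rewrite /pullback3.
have s1 (F : 'I_7 -> R) i : \sum_a (1%:M : 'M[R]_7) a i * F a = F i.
  rewrite (bigD1 i) //= mxE eqxx mul1r big1 ?addr0 // => a ai.
  by rewrite mxE (negbTE ai) mul0r.
under eq_bigr => a _ do under eq_bigr => b _ do under eq_bigr => c _ do rewrite -!mulrA.
under eq_bigr => a _ do under eq_bigr => b _ do rewrite -!mulr_sumr.
under eq_bigr => a _ do rewrite -mulr_sumr.
by rewrite s1 s1 s1.
Qed.

Lemma pullback3_inj A T T' : A \in unitmx -> pullback3 A T = pullback3 A T' -> T = T'.
Proof.
move=> uA /(congr1 (pullback3 (invmx A))).
by rewrite !pullback3M mulmxV // !pullback3_1.
Qed.

Lemma pullback3_cyc A T a b c :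
  pullback3 A T b c a = pullback3 A (fun i j k => T j k i) a b c.
Proof.
rewrite /pullback3; under eq_bigr => i _ do rewrite exchange_big.
rewrite exchange_big; apply: eq_bigr => k _; apply: eq_bigr => i _.
by apply: eq_bigr => j _; ring.
Qed.

Lemma pullback3_swap A T a b c :
  pullback3 A T b a c = pullback3 A (fun i j k => T j i k) a b c.
Proof.
rewrite /pullback3 exchange_big; apply: eq_bigr => i _; apply: eq_bigr => j _.
by apply: eq_bigr => k _; ring.
Qed.

Lemma skew3_pullback A T : skew3 (pullback3 A T) = pullback3 A (skew3 T).
Proof.
have e (T1 T2 T3 T4 T5 T6 : form3 R) a b c k :
    k * (pullback3 A T1 a b c + pullback3 A T2 a b c + pullback3 A T3 a b c
      - pullback3 A T4 a b c - pullback3 A T5 a b c - pullback3 A T6 a b c)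
    = pullback3 A (fun a b c => k * (T1 a b c + T2 a b c + T3 a b c
                                     - T4 a b c - T5 a b c - T6 a b c)) a b c.
  rewrite /pullback3 -!big_split /= -!sumrB mulr_sumr; apply: eq_bigr => p _ /=.
  rewrite -!big_split /= -!sumrB mulr_sumr; apply: eq_bigr => q _ /=.
  rewrite -!big_split /= -!sumrB mulr_sumr; apply: eq_bigr => r _ /=.
  by ring.
apply: funext => a; apply: funext => b; apply: funext => c; rewrite {1}/skew3.
pose rot (U : form3 R) : form3 R := fun i j k => U j k i.
pose swp (U : form3 R) : form3 R := fun i j k => U j i k.
have rotE U x y z : pullback3 A U y z x = pullback3 A (rot U) x y z by exact: pullback3_cyc.
have swpE U x y z : pullback3 A U y x z = pullback3 A (swp U) x y z by exact: pullback3_swap.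
have E2 : pullback3 A T c a b = pullback3 A (rot (rot T)) a b c by rewrite (rotE T b c a) rotE.
have E4 : pullback3 A T a c b = pullback3 A (swp (rot T)) a b c by rewrite (rotE T b a c) swpE.
have E5 : pullback3 A T c b a = pullback3 A (swp (rot (rot T))) a b c.
  by rewrite (rotE T a c b) (rotE (rot T) b a c) swpE.
rewrite (rotE T a b c) E2 (swpE T a b c) E4 E5.
by rewrite e.
Qed.

(** Naturality of i. For the metric A^T A, raising an index of A^T h A gives the endomorphism [M],
    and composed with the A^T of the first slot of the pullback it leaves A^T h. *)
Lemma sym_action_pullback A v h : A \in unitmx ->
  skew3 (fun a b c => \sum_i \sum_j (A^T *m h *m A) a i * invmx (A^T *m A) i j *
                        pullback3 A (spinor_form C v) j b c) =
  pullback3 A (sym_action C v h).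
Proof.
move=> uA; rewrite /sym_action -skew3_pullback; congr skew3.
apply: funext => a; apply: funext => b; apply: funext => c.
pose M := A^T *m h *m A *m invmx (A^T *m A).
have MA : M *m A^T = A^T *m h.
  apply: (can_inj (mulmxK uA)); rewrite -[LHS]mulmxA mulmxKV //.
  by rewrite unitmx_mul unitmx_tr uA.
transitivity (\sum_j M a j * pullback3 A (spinor_form C v) j b c).
  rewrite exchange_big; apply: eq_bigr => j _.
  by rewrite [M a j]mxE mulr_suml.
transitivity (\sum_p (M *m A^T) a p * \sum_q \sum_r A q b * A r c * spinor_form C v p q r).
  rewrite /pullback3; under eq_bigr => j _ do rewrite mulr_sumr.
  rewrite exchange_big; apply: eq_bigr => p _; rewrite mxE mulr_suml.
  apply: eq_bigr => j _; rewrite !mulr_sumr; apply: eq_bigr => q _.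
  by rewrite !mulr_sumr; apply: eq_bigr => r _; rewrite [A^T j p]mxE; ring.
rewrite MA /pullback3; under eq_bigr => p _ do rewrite mxE mulr_suml.
rewrite exchange_big; apply: eq_bigr => m _.
under eq_bigr => p _ do rewrite mulr_sumr.
rewrite exchange_big; apply: eq_bigr => q _.
under eq_bigr => p _ do rewrite mulr_sumr.
rewrite exchange_big; apply: eq_bigr => r _; rewrite mulr_sumr.
by apply: eq_bigr => p _; rewrite mxE; ring.
Qed.

Lemma wedge_pairing_sym_action v h k x : dotp v v = 1 -> h^T = h -> k^T = k ->
  wedge_pairing C (sym_action C v h) (sym_action C v k) x =
  64 * \sum_i x i * \tr (h *m k *m ((gam_frame C v)^T *m gam C i *m gam_frame C v)).
Proof.
move=> v1 hs ks; rewrite /wedge_pairing !clifford_sym_action // mulmxA mxtrace_mulC.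
rewrite mxtrace_sum1 mulr_sumr; apply: eq_bigr => i _.
by rewrite mxtrace_mulC mxtrace_sym_clifford // mulrCA.
Qed.

Lemma covector_pullback A (x : 'I_7 -> R) : A \in unitmx ->
  exists y, x = fun i => \sum_a y a * A a i.
Proof.
move=> uA; exists (fun a => \sum_j x j * invmx A j a).
apply: funext => i; pose X := \row_j x j.
have -> : x i = (X *m invmx A *m A) 0 i by rewrite mulmxKV // mxE.
rewrite mxE; apply: eq_bigr => a _; rewrite mxE; congr (_ * _).
by apply: eq_bigr => j _; rewrite mxE.
Qed.

(** Transposing h k L with h, k symmetric and L skew exchanges h and k and changes the sign of the
    trace. *)
Lemma wedge_pairing_skew A v h k x : dotp v v = 1 -> A \in unitmx -> h^T = h -> k^T = k ->
  wedge_pairing C (pullback3 A (sym_action C v h)) (pullback3 A (sym_action C v k)) x =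
  - wedge_pairing C (pullback3 A (sym_action C v k)) (pullback3 A (sym_action C v h)) x.
Proof.
move=> v1 uA hs ks; have [y ->] := covector_pullback x uA.
rewrite !wedge_pairing_pullback !wedge_pairing_sym_action // -!mulrN -sumrN.
congr (_ * (_ * _)); apply: eq_bigr => i _; rewrite -mulrN; congr (_ * _).
set L := _ *m _ *m gam_frame C v.
have Ls : L^T = - L by rewrite !trmx_mul trmxK gam_skew mulNmx mulmxN mulmxA.
rewrite -[LHS]mxtrace_tr (trmx_mul (h *m k) L) (trmx_mul h k) hs ks Ls.
by rewrite mulNmx raddfN /= mxtrace_mulC.
Qed.

(** As w = i(1), the trace formula reduces to tr(h L) with h symmetric and L skew. *)
Lemma wedge_pairing_spinor_form A v h x : dotp v v = 1 -> A \in unitmx -> h^T = h ->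
  wedge_pairing C (pullback3 A (sym_action C v h)) (pullback3 A (spinor_form C v)) x = 0.
Proof.
move=> v1 uA hs.
have [y ->] := covector_pullback x uA; rewrite wedge_pairing_pullback.
have -> : wedge_pairing C (sym_action C v h) (spinor_form C v) y
  = \tr (sym_clifford C v h *m (sym_clifford C v 1%:M *m \sum_i y i *: gam C i)).
  by rewrite /wedge_pairing clifford_sym_action // clifford_spinor_form.
rewrite mulmxA mxtrace_mulC mxtrace_sum1 big1 ?mulr0 // => i _.
rewrite mxtrace_mulC mxtrace_sym_clifford ?trmx1 // mulmx1 mxtrace_sym_skew ?mulr0 //.
by rewrite !trmx_mul trmxK gam_skew mulNmx mulmxN !mulmxA.
Qed.

(** For h = e_p e_p^T and k = e_p e_q^T + e_q e_p^T the product h k is e_p e_q^T, so the trace picks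
    out the single entry w_qpi. Some i makes it nonzero, as the squares of w_qpi sum to 1 over i. *)
Lemma wedge_pairing_neq0 A v : dotp v v = 1 -> A \in unitmx ->
  exists h k x, [/\ h^T = h, k^T = k & wedge_pairing C (pullback3 A (sym_action C v h))
                                       (pullback3 A (sym_action C v k)) x != 0].
Proof.
move=> v1 uA; pose p : 'I_7 := ord0; pose q : 'I_7 := lift ord0 ord0.
have [i wi] : exists i, spinor_form C v q p i != 0.
  apply: contrapT => H.
  have := spinor_form_contract1 C v1 q p q; rewrite eqxx big1 => [|i _].
    by rewrite (_ : q == p = false) // mulr0 subr0 => /esym/eqP; rewrite oner_eq0.
  by have [->|ne] := eqVneq (spinor_form C v q p i) 0; [rewrite mul0r | case: H; exists i].
pose x a : R := (a == i)%:R.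
have hs : (delta_mx p p : 'M[R]_7)^T = delta_mx p p by rewrite trmx_delta.
have ks : (delta_mx p q + delta_mx q p : 'M[R]_7)^T = delta_mx p q + delta_mx q p.
  by rewrite linearD /= !trmx_delta addrC.
exists (delta_mx p p), (delta_mx p q + delta_mx q p), (fun j => \sum_a x a * A a j); split => //.
rewrite wedge_pairing_pullback mulf_neq0 //; first by move: uA; rewrite unitmxE unitfE.
rewrite wedge_pairing_sym_action //.
rewrite mulmxDr mul_delta_mx mul_delta_mx_0 // addr0 mulf_neq0 ?pnatr_eq0 //.
rewrite (bigD1 i) //= {1}/x eqxx mul1r big1 ?addr0 => [|j ji]; last first.
  by rewrite /x (negbTE ji) mul0r.
have -> (L : 'M[R]_7) : \tr (delta_mx p q *m L) = L q p.
  rewrite /mxtrace (bigD1 p) //= big1 ?addr0 => [|j jp].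
    rewrite mxE (bigD1 q) //= big1 ?addr0 => [|j jq].
      by rewrite mxE !eqxx mul1r.
    by rewrite mxE (negbTE jq) andbF mul0r.
  by rewrite mxE big1 // => l _; rewrite mxE (negbTE jp) mul0r.
by rewrite gam_frame_gam spinor_form_cyc.
Qed.

End PulledBackForms.

(** * Positive matrices and the square root of 1 + tA *)

Section SymmetricMatrices.
Context (R : realType).

(** The spectral theorem over [R[i]], brought back to R because real matrices that are similar over
    the complex numbers are similar over R. The resulting P is invertible but need not be
    orthogonal. *)
Lemma sym_diagonalizable n (A : 'M[R]_n) : A^T = A ->
  exists (P : 'M[R]_n) (d : 'rV[R]_n), P \in unitmx /\ P *m A = diag_mx d *m P.
Proof.
move=> As; pose toC : {rmorphism R -> R[i]} := real_complex R.
have realC m k (B : 'M[R]_(m, k)) : map_mx toC B \is a mxOver Num.real.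
  by apply/mxOverP => i j; rewrite mxE /= complex_real.
have toCI m k (B : 'M[R[i]]_(m, k)) : B \is a mxOver Num.real ->
    B = map_mx toC (map_mx (@complex.Re R) B).
  by move=> /mxOverP Br; apply/matrixP => i j; rewrite !mxE [RHS]RRe_real.
set A' := map_mx toC A.
have Ah : A' \is hermsymmx.
  apply: realsym_hermsym (realC _ _ _).
  apply/is_hermitianmxP; rewrite expr0 scale1r.
  by apply/matrixP => i j; rewrite !mxE -[in LHS]As mxE.
have /hermitian_normalmx/orthomx_spectralP As' := Ah.
have dr := hermitian_spectral_diag_real Ah.
have sim : similar_in unitmx A' (diag_mx (spectral_diag A')).
  exists (spectralmx A'); first exact: spectral_unit.
  apply/similarP; first exact: spectral_unit.
  by move/(congr1 (mulmx (spectralmx A'))): As'; rewrite -(mulmxA (invmx _)) mulKVmx ?spectral_unit.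
have [|Q /andP[Qr Qu]] := real_similar sim (realC _ _ _).
  apply/mxOverP => i j; rewrite mxE; case: eqP => _; rewrite ?mulr1n ?mulr0n ?real0 //.
  by move/mxOverP: dr.
move=> /(similarP Qu); rewrite (toCI _ _ _ Qr) (toCI _ _ _ dr).
set P := map_mx _ Q; set d := map_mx _ (spectral_diag A').
rewrite -map_diag_mx /A' -!map_mxM => e; exists P, d; split.
  by move: Qu; rewrite (toCI _ _ _ Qr) map_unitmx.
apply/matrixP => i j; move/matrixP/(_ i j): e; rewrite !mxE => /complexI.
by [].
Qed.

Lemma posdefP n (A : 'M[R]_n) : posdef A <->
  A^T = A /\ forall X : 'cV[R]_n, X != 0 -> 0 < dotp X (A *m X).
Proof. by rewrite /posdef /dotp; split=> -[As Ap]; split => // X /Ap; rewrite mulmxA. Qed.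

Lemma dotp_gt0 n (X : 'cV[R]_n) : X != 0 -> 0 < dotp X X.
Proof.
move=> X0; rewrite lt_neqAle dotpE sumr_ge0 ?andbT => [|i _]; last by rewrite -expr2 sqr_ge0.
rewrite eq_sym; apply: contra_neq X0 => /eqP.
rewrite psumr_eq0 => [/allP e|i _]; last by rewrite -expr2 sqr_ge0.
apply/colP => i; rewrite mxE; apply/eqP.
by have := e i (mem_index_enum _); rewrite mulf_eq0 orbb.
Qed.

Lemma posdef_unit n (A : 'M[R]_n) : posdef A -> A \in unitmx.
Proof.
move=> /posdefP[As Ap]; rewrite -row_free_unit -kermx_eq0; apply/eqP/row_matrixP => i.
rewrite row0; set u := row i _.
have uA : u *m A = 0 by apply/sub_kermxP; exact: row_sub.
apply: contrapT => /eqP u0; have := Ap u^T.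
by rewrite trmx_eq0 => /(_ u0); rewrite -{1}As -trmx_mul uA trmx0 /dotp mulmx0 mxE ltxx.
Qed.

Lemma posdef_congr n (A B : 'M[R]_n) : B \in unitmx -> posdef A -> posdef (B^T *m A *m B).
Proof.
move=> uB [As Ap]; split=> [|X X0]; first by rewrite !trmx_mul trmxK As mulmxA.
have := Ap (B *m X); rewrite trmx_mul !mulmxA; apply.
by apply: contra_neq X0 => e; rewrite -[X](mulKmx uB) e mulmx0.
Qed.

Lemma posdef1 n : posdef (1%:M : 'M[R]_n).
Proof. by apply/posdefP; split=> [|X X0]; rewrite ?trmx1 // mul1mx dotp_gt0. Qed.

Lemma mxtrace_congr n (A N : 'M[R]_n) :
  \tr (N^T *m A *m N) = \sum_i dotp (col i N) (A *m col i N).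
Proof.
apply: eq_bigr => i _; rewrite -mulmxA mxE dotpE; apply: eq_bigr => k _.
rewrite !mxE; congr (_ * _); apply: eq_bigr => l _; by rewrite mxE.
Qed.

Lemma posdef_ge0 n (A : 'M[R]_n) X : posdef A -> 0 <= dotp X (A *m X).
Proof.
move=> /posdefP[_ Ap]; have [->|/Ap/ltW //] := eqVneq X 0.
by rewrite mulmx0 /dotp mulmx0 mxE.
Qed.

Lemma posdef_mxtrace_ge0 n (A N : 'M[R]_n) : posdef A -> 0 <= \tr (N^T *m A *m N).
Proof. by move=> Ap; rewrite mxtrace_congr sumr_ge0 // => i _; apply: posdef_ge0. Qed.

Lemma posdef_mxtrace_eq0 n (A N : 'M[R]_n) : posdef A -> \tr (N^T *m A *m N) = 0 -> N = 0.
Proof.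
move=> Ap /eqP; rewrite mxtrace_congr psumr_eq0 => [/allP e|i _]; last exact: posdef_ge0.
apply/matrixP => k i; rewrite mxE.
have c0 : col i N = 0.
  apply: contrapT => /eqP c0; have /posdefP[_ /(_ _ c0)] := Ap.
  by rewrite (eqP (implyP (e i (mem_index_enum _)) isT)) ltxx.
by have /matrixP/(_ k 0) := c0; rewrite !mxE.
Qed.

(** With N = A - B one has A N + N B = A^2 - B^2 = 0, so tr(N A N) + tr(N B N) = 0. Both traces are
    nonnegative, and the first vanishes only for N = 0. *)
Lemma posdef_sqr_inj n (A B : 'M[R]_n) : posdef A -> posdef B -> A *m A = B *m B -> A = B.
Proof.
move=> Ap Bp AB; pose N := A - B; have [As _] := Ap; have [Bs _] := Bp.
have Ns : N^T = N by rewrite linearB /= As Bs.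
have e : \tr (N^T *m A *m N) + \tr (N^T *m B *m N) = 0.
  have -> : \tr (N^T *m B *m N) = \tr (N^T *m N *m B).
    by rewrite Ns mxtrace_mulC mulmxA.
  rewrite -mxtraceD -!mulmxA -mulmxDr (_ : _ + _ = 0) ?mulmx0 ?mxtrace0 //.
  by rewrite /N mulmxBr mulmxBl AB addrA subrK subrr.
apply/eqP; rewrite -subr_eq0 -/N; apply/eqP/(posdef_mxtrace_eq0 Ap).
by have := posdef_mxtrace_ge0 N Ap; have := posdef_mxtrace_ge0 N Bp; lra.
Qed.

Section FunctionalCalculus.
Context (n : nat) (A P : 'M[R]_n) (d : 'rV[R]_n).
Hypotheses (As : A^T = A) (uP : P \in unitmx) (PA : P *m A = diag_mx d *m P).

Definition fun_mx (f : R -> R) : 'M[R]_n := invmx P *m diag_mx (map_mx f d) *m P.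

Lemma fun_mxE f i j : fun_mx f i j = \sum_k invmx P i k * f (d 0 k) * P k j.
Proof. by rewrite mxE; apply: eq_bigr => k _; rewrite mul_mx_diag !mxE. Qed.

Lemma eq_fun_mx f h : (forall k, f (d 0 k) = h (d 0 k)) -> fun_mx f = fun_mx h.
Proof.
by move=> fh; congr (_ *m diag_mx _ *m _); apply/rowP => k; rewrite !mxE fh.
Qed.

Lemma fun_mxM f h : fun_mx f *m fun_mx h = fun_mx (fun x => f x * h x).
Proof.
rewrite /fun_mx -!mulmxA; congr (_ *m _); rewrite mulKVmx // mulmxA; congr (_ *m _).
apply/matrixP => i j; rewrite mul_diag_mx !mxE.
by case: eqP => [->|_]; rewrite ?mulr1n ?mulr0n ?mulr0.
Qed.

Lemma fun_mx_aff a b : fun_mx (fun x => a + b * x) = a%:M + b *: A.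
Proof.
apply: (can_inj (mulKmx uP)); rewrite /fun_mx mulmxA mulKVmx // mulmxDr -scalemxAr PA.
rewrite mul_mx_scalar scalemxAl -[X in _ = X + _]mul_scalar_mx -mulmxDl; congr (_ *m _).
apply/matrixP => i j; rewrite !mxE.
by case: eqP => _; rewrite ?mulr1n ?mulr0n ?mulr0 ?addr0.
Qed.

(** P may fail to be orthogonal, but symmetry of A makes S = P P^T commute with diag d. So S_ij is
    zero unless d_i = d_j, and S commutes with diag (f d) too. *)
Lemma fun_mx_sym f : (fun_mx f)^T = fun_mx f.
Proof.
pose S := P *m P^T.
have PAP : P *m A *m P^T = diag_mx d *m S by rewrite PA mulmxA.
have DS : diag_mx d *m S = S *m diag_mx d.
  have e : (P *m A *m P^T)^T = P *m A *m P^T by rewrite !trmx_mul trmxK As mulmxA.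
  have ST : S^T = S by rewrite trmx_mul trmxK.
  by move: e; rewrite PAP trmx_mul tr_diag_mx ST => ->.
have comm (T : 'M[R]_n) : diag_mx d *m T = T *m diag_mx d ->
    diag_mx (map_mx f d) *m T = T *m diag_mx (map_mx f d).
  move=> dT; apply/matrixP => i j; move/matrixP/(_ i j): dT.
  rewrite !mul_diag_mx !mul_mx_diag !mxE; have [->|T0] := eqVneq (T i j) 0.
    by rewrite !mulr0 !mul0r.
  by rewrite mulrC => /(mulfI T0) ->; rewrite mulrC.
have fS := comm _ DS.
apply: (can_inj (mulKmx uP)); rewrite /fun_mx !mulmxA mulmxV // mul1mx.
apply: (can_inj (mulmxK (_ : P^T \in unitmx))); rewrite ?unitmx_tr //.
rewrite !trmx_mul tr_diag_mx -!mulmxA -/S fS /S !mulmxA.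
rewrite -(mulmxA _ _ P^T).
by rewrite -trmx_mul mulmxV // trmx1 mulmx1.
Qed.

Lemma fun_mx_inv f h : (forall k, f (d 0 k) * h (d 0 k) = 1) -> fun_mx f *m fun_mx h = 1%:M.
Proof.
move=> fh; rewrite fun_mxM (_ : fun_mx _ = fun_mx (fun x => 1 + 0 * x)).
  by rewrite fun_mx_aff scale0r addr0.
by apply: eq_fun_mx => k; rewrite fh mul0r addr0.
Qed.

Lemma fun_mx_posdef f : (forall k, 0 < f (d 0 k)) -> posdef (fun_mx f).
Proof.
(* f(A) is the congruence of the identity by the symmetric invertible matrix h(A). *)
move=> f0; pose h x := Num.sqrt (f x).
have hh : fun_mx h *m fun_mx h = fun_mx f.
  by rewrite fun_mxM; apply: eq_fun_mx => k; rewrite -expr2 sqr_sqrtr // ltW.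
have uh : fun_mx h \in unitmx.
  suff /mulmx1_unit[] : fun_mx h *m fun_mx (fun x => (h x)^-1) = 1%:M by [].
  by apply: fun_mx_inv => k; rewrite divff // gt_eqF // sqrtr_gt0.
have := posdef_congr uh (@posdef1 n).
by rewrite fun_mx_sym mulmx1 hh.
Qed.

End FunctionalCalculus.

Lemma continuous_mxP (T : topologicalType) m n (M : T -> 'M[R]_(m, n)) t :
  (forall i j, {for t, continuous (fun x => M x i j)}) -> {for t, continuous M}.
Proof.
move=> Mc; apply/cvgrPdist_le => /= e e0; near=> x.
rewrite /Num.Def.normr/= mx_normrE (bigmax_le _ (ltW e0))//= => i _.
rewrite !mxE/=; move: i; near: x; apply: filter_forall => /= i.
exact: ((cvgrPdist_le _ _).1 (Mc i.1 i.2)).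
Unshelve. all: by end_near. Qed.

Lemma is_derive_bigsum (V : normedModType R) n (h : 'I_n -> V -> R) x v (dh : 'I_n -> R) :
  (forall k, is_derive x v (h k) (dh k)) ->
  is_derive x v (fun t => \sum_k h k t) (\sum_k dh k).
Proof.
by move=> H; have := is_derive_sum H; congr is_derive; apply: funext => t; rewrite fct_sumE.
Qed.

Lemma is_derive_mul (V : normedModType R) (f h : V -> R) x v (df dh : R) :
  is_derive x v f df -> is_derive x v h dh ->
  is_derive x v (fun t => f t * h t) (f x * dh + h x * df).
Proof. by move=> ? ?; apply: is_deriveM. Qed.

Lemma is_derive_sqrt_affine (c t : R) : 0 < 1 + c * t ->
  is_derive t 1 (fun t => Num.sqrt (1 + c * t)) ((2 * Num.sqrt (1 + c * t))^-1 * c).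
Proof.
move=> t0; apply: (@is_derive1_comp R Num.sqrt (fun t => 1 + c * t)); first exact: is_derive1_sqrt.
have h : is_derive t 1 (fun t1 : R => 1 + c * t1) (0 + (c * 1 + t * 0)).
  by apply: is_deriveD; exact: is_derive_mul.
by apply: (trigger_derive h); ring.
Qed.

Lemma derivable_continuous (f : R -> R) t : derivable f t 1 -> {for t, continuous f}.
Proof. by move=> /derivable1_diffP; exact: differentiable_continuous. Qed.

(** The root [sqrt (1 + t A)] is evaluated on the eigenvalues of [A]. *)
Lemma sqrt_path n (A : 'M[R]_n) : A^T = A ->
  exists Cp Cq : R -> 'M[R]_n,
    [/\ \forall t \near (0 : R), [/\ posdef (Cp t), Cp t *m Cp t = 1%:M + t *: A,
                               Cp t *m Cq t = 1%:M & {for t, continuous Cq}],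
        Cp 0 = 1%:M
      & forall i j, is_derive (0 : R) 1 (fun t => Cp t i j) (2^-1 * A i j)].
Proof.
move=> As; have [P [d [uP PA]]] := sym_diagonalizable As.
pose f (t x : R) := Num.sqrt (1 + x * t).
exists (fun t => fun_mx P d (f t)), (fun t => fun_mx P d (fun x => (f t x)^-1)); split.
- have near0 k : \forall t \near (0 : R), 0 < 1 + d 0 k * t.
    have c : {for 0, continuous (fun t => 1 + d 0 k * t : R)}.
      by apply: cvgD; [exact: cvg_cst|apply: cvgM; [exact: cvg_cst|exact: cvg_id]].
    by apply: (cvgr_gt _ c); rewrite /= mulr0 addr0.
  near=> t; have t0 k : 0 < 1 + d 0 k * t.
    by move: k; near: t; apply: filter_forall => k; exact: near0.
  split.
  + by apply: (fun_mx_posdef As uP PA) => k; rewrite sqrtr_gt0.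
  + rewrite (fun_mxM _ uP) -(fun_mx_aff uP PA); apply: eq_fun_mx => k.
    by rewrite -expr2 sqr_sqrtr ?ltW // mulrC.
  + by apply: (fun_mx_inv uP PA) => k; rewrite divff // gt_eqF // sqrtr_gt0.
  + apply: continuous_mxP => i j.
    have -> : (fun s => fun_mx P d (fun x => (f s x)^-1) i j)
      = fun s => \sum_k (invmx P i k * P k j) * (f s (d 0 k))^-1.
      by apply: funext => s; rewrite fun_mxE; apply: eq_bigr => k _; rewrite mulrAC.
    apply: derivable_continuous.
    have H k : derivable (fun s : R => (invmx P i k * P k j) * (f s (d 0 k))^-1) t 1.
      apply: derivableM; first exact: derivable_cst.
      apply: derivableV; first by rewrite gt_eqF // sqrtr_gt0.
      by have [] := is_derive_sqrt_affine (t0 k).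
    by have [] := is_derive_bigsum (fun k => DeriveDef (H k) erefl).
- rewrite (_ : fun_mx P d (f 0) = fun_mx P d (fun x => 1 + 0 * x)).
    by rewrite (fun_mx_aff uP PA) scale0r addr0.
  by apply: eq_fun_mx => k; rewrite /f mulr0 mul0r addr0 sqrtr1.
- move=> i j.
  have -> : (fun s => fun_mx P d (f s) i j)
    = fun s => \sum_k (invmx P i k * P k j) * (f s (d 0 k)).
    by apply: funext => s; rewrite fun_mxE; apply: eq_bigr => k _; rewrite mulrAC.
  have -> : 2^-1 * A i j = \sum_k (invmx P i k * P k j) * (2^-1 * d 0 k).
    have -> : A = fun_mx P d (fun x => 0 + 1 * x).
      by rewrite (fun_mx_aff uP PA) scale1r raddf0 add0r.
    by rewrite fun_mxE mulr_sumr; apply: eq_bigr => k _; ring.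
  apply: is_derive_bigsum => k.
  have h1 : 0 < 1 + d 0 k * 0 :> R by rewrite mulr0 addr0.
  have := is_derive_mul (is_derive_cst (invmx P i k * P k j : R) (0 : R) 1) (is_derive_sqrt_affine h1).
  by move/trigger_derive; apply; rewrite mulr0 addr0 sqrtr1 mulr1 mulr0 addr0.
Unshelve. all: by end_near. Qed.

End SymmetricMatrices.

(** * Calculus of [Ck] functions and symmetry of second derivatives *)

Section Smoothness.
Context (R : realType) (V : normedModType R).
Implicit Types (U : set V) (f h : V -> R) (p u v : V).

Lemma near_eq_differentiable f h p :
  (\forall q \near p, f q = h q) -> differentiable f p -> differentiable h p.
Proof.
move=> fh df; have /diff_locallyP[cdf /eqaddoP ef] := df.
have fhp : f p = h p by apply: nbhs_singleton fh.
have fh0 : \forall x \near (0 : V), f (x + p) = h (x + p).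
  by move: fh; rewrite (near_shift (0 : V)) subr0.
have eh : h \o shift p = cst (h p) + 'd f p +o_ (0 : V) id.
  apply/eqaddoP => e e0; have := ef e e0; apply: filterS2 fh0.
  by move=> x fhx; rewrite !fctE /= -fhx fhp.
have dE := diff_unique cdf eh.
by apply/diff_locallyP; rewrite dE.
Qed.

Lemma is_derive_line f p v s : derivable f (p + s *: v) v ->
  is_derive s 1 (fun t : R => f (p + t *: v)) ('D_v f (p + s *: v)).
Proof.
move=> df.
have e : (fun h : R => h^-1 *: (((fun t : R => f (p + t *: v)) \o shift s) (h *: 1) - f (p + s *: v)))
   = (fun h : R => h^-1 *: ((f \o shift (p + s *: v)) (h *: v) - f (p + s *: v))).
  apply: funext => t /=; congr (_ *: (f _ - _)).
  by rewrite [t *: 1]mulr1 scalerDl addrCA.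
by split; rewrite /derivable /derive e.
Qed.

Lemma CkW k U f : Ck k.+1 U f -> Ck k U f.
Proof.
elim: k f => [f [df _] p Up|k IH f [df Df]]; first exact: differentiable_continuous (df p Up).
by split=> // v; apply: IH.
Qed.

(** [Ck] recurses on the global function ['D_v f], whereas derivation rules compute it on U only;
    each closure property below passes through this lemma or avoids the gap by a global identity. *)
Lemma eq_Ck k U f h : open U -> (forall p, U p -> f p = h p) -> Ck k U f -> Ck k U h.
Proof.
move=> oU; elim: k f h => [|k IH] f h fh.
  move=> cf p Up; have nfh : \forall q \near p, f q = h q.
    by apply: filterS (open_nbhs_nbhs (conj oU Up)); exact: fh.
  rewrite /prop_for /continuous_at -fh //.
  by apply: cvg_trans (cf p Up); exact: near_eq_cvg.
move=> [df Df]; have nfh p : U p -> \forall q \near p, f q = h q.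
  by move=> Up; apply: filterS (open_nbhs_nbhs (conj oU Up)); exact: fh.
split=> [p Up|v]; first exact: near_eq_differentiable (nfh p Up) (df p Up).
apply: IH (Df v) => p Up; exact: near_eq_derive (nfh p Up).
Qed.

Lemma Ck_cst k U (a : R) : Ck k U (fun=> a).
Proof.
elim: k a => [a p _|k IH a]; first exact: cvg_cst.
split=> [p _|v]; first exact: differentiable_cst.
have -> : 'D_v (fun _ : V => a) = fun=> 0 by apply: funext => p; exact: derive_cst.
exact: IH.
Qed.

Lemma Ck_linear k U f : (forall a u v, f (a *: u + v) = a * f u + f v) ->
  continuous f -> Ck k U f.
Proof.
move=> flin fc.
have flin' : linear f by move=> a u v; rewrite flin.
pose F : {linear V -> R} := HB.pack f (GRing.isLinear.Build R V R _ f flin').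
have Fc : continuous F by [].
case: k => [|k]; first by move=> p _; exact: fc.
split=> [p _|v]; first exact: (linear_differentiable (f := F)).
have -> : 'D_v f = fun=> f v.
  apply: funext => p; rewrite deriveE; last exact: (linear_differentiable (f := F)).
  by rewrite (diff_lin (f := F)).
exact: Ck_cst.
Qed.

Lemma Ck_add k U f h : open U -> Ck k U f -> Ck k U h -> Ck k U (fun p => f p + h p).
Proof.
move=> oU; elim: k f h => [|k IH] f h.
  by move=> cf ch p Up; apply: cvgD; [exact: cf|exact: ch].
move=> [df Df] [dh Dh]; split=> [p Up|v]; first by apply: differentiableD; [exact: df|exact: dh].
apply: (eq_Ck oU _ (IH _ _ (Df v) (Dh v))) => p Up.
by rewrite deriveD //; apply: diff_derivable; [exact: df|exact: dh].
Qed.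

Lemma Ck_mul k U f h : open U -> Ck k U f -> Ck k U h -> Ck k U (fun p => f p * h p).
Proof.
move=> oU; elim: k f h => [|k IH] f h.
  by move=> cf ch p Up; apply: cvgM; [exact: cf|exact: ch].
move=> cf ch; have [df Df] := cf; have [dh Dh] := ch.
split=> [p Up|v]; first by apply: differentiableM; [exact: df|exact: dh].
apply: (eq_Ck oU _ (Ck_add oU (IH _ _ (CkW cf) (Dh v)) (IH _ _ (CkW ch) (Df v)))) => p Up.
by rewrite deriveM //; apply: diff_derivable; [exact: df|exact: dh].
Qed.

Lemma Ck_inv k U f : open U -> (forall p, U p -> f p != 0) -> Ck k U f ->
  Ck k U (fun p => (f p)^-1).
Proof.
move=> oU f0; elim: k => [|k IH].
  by move=> cf p Up; apply: cvgV; [exact: f0|exact: cf].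
move=> cf; have [df Df] := cf.
split=> [p Up|v]; first by apply: differentiableV; [exact: df|exact: f0].
have cV := IH (CkW cf).
have := Ck_mul oU (Ck_cst k U (- 1)) (Ck_mul oU (Ck_mul oU cV cV) (Df v)).
apply: (eq_Ck oU) => p Up; rewrite deriveV; [|exact: f0|by apply: diff_derivable; exact: df].
by rewrite -exprVn expr2 [in RHS]/GRing.scale /= mulN1r mulNr.
Qed.

Lemma Ck_sum k U (I : finType) (F : I -> V -> R) : open U ->
  (forall i, Ck k U (F i)) -> Ck k U (fun p => \sum_i F i p).
Proof.
move=> oU cF; elim: (index_enum I) => [|i r IH].
  by under eq_fun do rewrite big_nil; exact: Ck_cst.
by under eq_fun do rewrite big_cons; exact: Ck_add.
Qed.

Lemma Ck_prod k U (I : finType) (F : I -> V -> R) : open U ->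
  (forall i, Ck k U (F i)) -> Ck k U (fun p => \prod_i F i p).
Proof.
move=> oU cF; elim: (index_enum I) => [|i r IH].
  by under eq_fun do rewrite big_nil; exact: Ck_cst.
by under eq_fun do rewrite big_cons; exact: Ck_mul.
Qed.

Lemma Ck_det k U n (M : V -> 'M[R]_n) : open U ->
  (forall i j, Ck k U (fun p => M p i j)) -> Ck k U (fun p => \det (M p)).
Proof.
move=> oU cM; apply: Ck_sum => // s; apply: Ck_mul => //; first exact: Ck_cst.
by apply: Ck_prod => // i; exact: cM.
Qed.

Lemma Ck_invmx k U n (M : V -> 'M[R]_n) : open U -> (forall p, U p -> \det (M p) != 0) ->
  (forall i j, Ck k U (fun p => M p i j)) ->
  forall i j, Ck k U (fun p => invmx (M p) i j).
Proof.
move=> oU d0 cM i j.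
have cadj : Ck k U (fun p => \adj (M p) i j).
  have -> : (fun p => \adj (M p) i j)
     = fun p => (- 1) ^+ (j + i) * \det (row' j (col' i (M p))).
    by apply: funext => p; rewrite mxE.
  apply: Ck_mul => //; first exact: Ck_cst.
  by apply: Ck_det => // a b; under eq_fun do rewrite !mxE; exact: cM.
apply: (eq_Ck oU _ (Ck_mul oU (Ck_inv oU d0 (Ck_det oU cM)) cadj)) => p Up.
by rewrite /invmx unitmxE unitfE d0 // [RHS]mxE.
Qed.

(** The mean value theorem along v turns the second difference into t times an increment of
    ['D_v f], which is estimated by differentiability of ['D_v f] at u. The two error terms are
    bounded by e t (|v| + |w|) and e t |v|. *)
Lemma second_difference_le U f u v w e : open U -> U u -> Ck 2 U f -> 0 < e ->
  \forall t \near (0 : R)^'+,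
    `|f (u + t *: v + t *: w) - f (u + t *: v) - (f (u + t *: w) - f u)
      - t ^+ 2 * 'D_w ('D_v f) u| <= t ^+ 2 * (e * (2 * `|v| + `|w|)).
Proof.
move=> oU Uu [df Df] e0.
have [dDf _] := Df v.
have /diff_locallyP[cd /eqaddoP/(_ e e0) Hd] := dDf u Uu.
have Uu0 : \forall x \near (0 : V), U (x + u).
  have : \forall q \near u, U q by exact: open_nbhs_nbhs.
  by rewrite (near_shift (0 : V)) subr0.
have : nbhs (0 : V) (fun x => `|('D_v f \o shift u - (cst ('D_v f u) + 'd ('D_v f) u)) x|
    <= e * `|x| /\ U (x + u)) by apply: filterI.
move=> /nbhs_ballP[r r0 Hr].
have near0 : \forall t \near (0 : R)^'+, t * (`|v| + `|w|) < r.
  have c : {for 0, continuous (fun t : R => t * (`|v| + `|w|))}.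
    by apply: cvgM; [exact: cvg_id|exact: cvg_cst].
  have n0 : \forall t \near (0 : R), t * (`|v| + `|w|) < r.
    by apply: (cvgr_lt _ c); rewrite /= mul0r.
  by apply: cvg_within; exact: n0.
near=> t.
have t0 : 0 < t by near: t; exact: nbhs_right_gt.
have tr : t * (`|v| + `|w|) < r by near: t.
have small a b : 0 <= a <= t -> 0 <= b <= t -> ball (0 : V) r (a *: v + b *: w).
  move=> /andP[a0 at_] /andP[b0 bt]; rewrite -ball_normE /ball_ /= sub0r normrN.
  apply: le_lt_trans tr; apply: le_trans (ler_normD _ _) _.
  by rewrite !normrZ (ger0_norm a0) (ger0_norm b0) mulrDr lerD // ler_wpM2r.
pose phi s := f (u + t *: w + s *: v) - f (u + s *: v).
have Uab a b : 0 <= a <= t -> 0 <= b <= t -> U (u + b *: w + a *: v).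
  by move=> ha hb; have [_] := Hr _ (small a b ha hb); rewrite addrC -addrA [b *: w + _]addrC.
have tt : 0 <= t <= t by rewrite lexx ltW.
have h00 : 0 <= (0 : R) <= t by rewrite lexx ltW.
have dphi s : 0 <= s <= t -> is_derive s 1 phi
    ('D_v f (u + t *: w + s *: v) - 'D_v f (u + s *: v)).
  move=> st; apply: is_deriveB; apply: is_derive_line; apply: diff_derivable; apply: df.
    exact: Uab.
  by have := Uab s 0 st h00; rewrite scale0r addr0.
have [||c ct e1] := MVT t0 (f := phi)
    (df := fun s => 'D_v f (u + t *: w + s *: v) - 'D_v f (u + s *: v)).
- by move=> s; rewrite in_itv /= => /andP[s0 st]; apply: dphi; rewrite !ltW.
- apply: derivable_within_continuous => s; rewrite in_itv /= => st.
  by have [] := dphi s st.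
move: ct; rewrite in_itv /= => /andP[c0 ct].
have cc : 0 <= c <= t by rewrite !ltW.
have [H1 _] := Hr _ (small c t cc tt).
have [H2 _] := Hr _ (small c 0 cc h00).
move: H1 H2; rewrite !fctE /= scale0r addr0.
rewrite [_ + u]addrC [c *: v + t *: w]addrC addrA [c *: v + u]addrC.
set A := 'D_v f _; set B := 'D_v f (u + c *: v).
set L := 'd ('D_v f) u => H1 H2.
have LE : L (t *: w + c *: v) = t * L w + c * L v by rewrite linearD !linearZ.
have DE : 'D_w ('D_v f) u = L w by rewrite deriveE //; exact: dDf.
rewrite LE in H1; rewrite linearZ /= in H2.
have n1 : `|t *: w + c *: v| <= t * `|w| + t * `|v|.
  apply: le_trans (ler_normD _ _) _; rewrite !normrZ (gtr0_norm t0) (gtr0_norm c0).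
  by rewrite lerD2l ler_wpM2r // ltW.
have n2 : `|c *: v| <= t * `|v| by rewrite normrZ (gtr0_norm c0) ler_wpM2r // ltW.
have {}H1 := le_trans H1 (ler_wpM2l (ltW e0) n1).
have {}H2 := le_trans H2 (ler_wpM2l (ltW e0) n2).
have {e1} -> : f (u + t *: v + t *: w) - f (u + t *: v) - (f (u + t *: w) - f u)
     - t ^+ 2 * 'D_w ('D_v f) u
   = t * ((A - ('D_v f u + (t * L w + c * L v))) - (B - ('D_v f u + c *: L v))).
  have -> : f (u + t *: v + t *: w) - f (u + t *: v) - (f (u + t *: w) - f u) = (A - B) * t.
    by rewrite -[t in RHS]subr0 -e1 /phi !scale0r !addr0 [u + t *: v + _]addrAC.
  by rewrite DE /GRing.scale /=; ring.
rewrite normrM (gtr0_norm t0) expr2 -mulrA; apply: ler_wpM2l; first exact: ltW.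
apply: le_trans (ler_normB _ _) _; apply: le_trans (lerD H1 H2) _.
by rewrite le_eqVlt; apply/orP; left; apply/eqP; ring.
Unshelve. all: by end_near. Qed.

Lemma derive_comm U f u v w : open U -> U u -> Ck 2 U f ->
  'D_w ('D_v f) u = 'D_v ('D_w f) u.
Proof.
have bound (a b : R) : 2 * b + a + (2 * a + b) <= 3 * (a + b) + 1 by lra.
move=> oU Uu cf; apply/eqP; rewrite -subr_eq0 -normr_le0; apply/ler_addgt0Pl => e e0.
rewrite addr0.
(* The second difference is symmetric in v and w, so the two error constants add up to 3 (|v| +
   |w|); the 1 keeps k positive. *)
pose k := 3 * (`|v| + `|w|) + 1.
have k0 : 0 < k by rewrite ltr_wpDl // mulr_ge0 // addr_ge0.
have ek : 0 < e / k by rewrite divr_gt0.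
near (0 : R)^'+ => t.
have t0 : 0 < t by near: t; exact: nbhs_right_gt.
have H1 : `|f (u + t *: v + t *: w) - f (u + t *: v) - (f (u + t *: w) - f u)
      - t ^+ 2 * 'D_w ('D_v f) u| <= t ^+ 2 * (e / k * (2 * `|v| + `|w|)).
  by near: t; exact: (second_difference_le _ _ oU).
have H2 : `|f (u + t *: w + t *: v) - f (u + t *: w) - (f (u + t *: v) - f u)
      - t ^+ 2 * 'D_v ('D_w f) u| <= t ^+ 2 * (e / k * (2 * `|w| + `|v|)).
  by near: t; exact: (second_difference_le _ _ oU).
have t2 : 0 < t ^+ 2 by rewrite exprn_gt0.
rewrite -(ler_pM2l t2) -[X in X * _](gtr0_norm t2) -normrM.
have := lerD H2 H1.
move/(le_trans (ler_normB _ _)).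
rewrite [u + t *: w + t *: v]addrAC => H3.
have alg (a b c d x y s : R) :
    s * (x - y) = a - c - (b - d) - s * y - (a - b - (c - d) - s * x) by ring.
rewrite (alg (f (u + t *: v + t *: w)) (f (u + t *: v)) (f (u + t *: w)) (f u)).
apply: (le_trans H3); rewrite -mulrDr ler_pM2l // -mulrDr -ler_pdivlMl // invf_div.
by rewrite divfK ?gt_eqF // bound.
Unshelve. all: by end_near. Qed.

End Smoothness.

(** * Derivatives of pulled-back forms *)

Section PullbackDerivative.
Context (R : realType).
Implicit Types (T : form3 R).

Lemma is_derive_pullback3 (A : 'M[R]_7) (Tt : R -> form3 R) (dT : form3 R) (t : R) :
  (forall a b c, is_derive t (1 : R) (fun s => Tt s a b c : R) (dT a b c)) ->
  forall i j k, is_derive t (1 : R) (fun s => pullback3 A (Tt s) i j k) (pullback3 A dT i j k).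
Proof.
move=> H i j k.
by apply: is_derive_bigsum => a; apply: is_derive_bigsum => b; apply: is_derive_bigsum.
Qed.

Lemma is_derive_pullback3_1 (Cp : R -> 'M[R]_7) (D : 'M[R]_7) T :
  Cp 0 = 1%:M -> (forall i j, is_derive (0 : R) 1 (fun s => Cp s i j) (D i j)) ->
  forall i j k, is_derive (0 : R) 1 (fun s => pullback3 (Cp s) T i j k)
    (\sum_p D p i * T p j k + \sum_p D p j * T i p k + \sum_p D p k * T i j p).
Proof.
move=> C0 DC i j k.
pose I1 : 'M[R]_7 := 1%:M.
have H : is_derive (0 : R) 1 (fun s => pullback3 (Cp s) T i j k)
    (\sum_a \sum_b \sum_c (D a i * I1 b j * I1 c k * T a b c + I1 a i * D b j * I1 c k * T a b c
                           + I1 a i * I1 b j * D c k * T a b c)).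
  apply: is_derive_bigsum => a; apply: is_derive_bigsum => b; apply: is_derive_bigsum => c.
  have := is_derive_mul (is_derive_mul (is_derive_mul (DC a i) (DC b j)) (DC c k))
     (is_derive_cst (T a b c) (0 : R) 1).
  by move/trigger_derive; apply; rewrite C0 -/I1 /cst; ring.
apply: (trigger_derive H).
have s1 (F : 'I_7 -> R) l : \sum_a I1 a l * F a = F l.
  rewrite (bigD1 l) //= /I1 mxE eqxx mul1r big1 ?addr0 // => a al.
  by rewrite mxE (negbTE al) mul0r.
under eq_bigr => a _ do under eq_bigr => b _ do rewrite !big_split /=.
under eq_bigr => a _ do rewrite !big_split /=.
rewrite !big_split /=; congr (_ + _ + _).
- apply: eq_bigr => a _; rewrite -(s1 (fun b => D a i * T a b k)).
  apply: eq_bigr => b _; rewrite -(s1 (fun c => I1 b j * (D a i * T a b c))).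
  by apply: eq_bigr => c _; ring.
- rewrite -[RHS](s1 (fun a => \sum_b D b j * T a b k)); apply: eq_bigr => a _.
  rewrite mulr_sumr; apply: eq_bigr => b _.
  rewrite -[RHS](s1 (fun c => I1 a i * (D b j * T a b c))).
  by apply: eq_bigr => c _; ring.
- rewrite -[RHS](s1 (fun a => \sum_c D c k * T a j c)); apply: eq_bigr => a _.
  rewrite -[RHS](s1 (fun b => I1 a i * \sum_c D c k * T a b c)); apply: eq_bigr => b _.
  by rewrite !mulr_sumr; apply: eq_bigr => c _; ring.
Qed.

Lemma is_derive_sym_action (C : clifford_module R) v (Cp : R -> 'M[R]_7) (h : 'M[R]_7) :
  h^T = h -> Cp 0 = 1%:M ->
  (forall i j, is_derive (0 : R) 1 (fun s => Cp s i j) (2^-1 * h i j)) ->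
  forall i j k, is_derive (0 : R) 1 (fun s => pullback3 (Cp s) (spinor_form C v) i j k)
    (3 / 2 * sym_action C v h i j k).
Proof.
move=> hs C0 DC i j k; pose D : 'M[R]_7 := 2^-1 *: h.
have DC' a b : is_derive (0 : R) 1 (fun s => Cp s a b) (D a b).
  by have := DC a b; rewrite /D mxE.
apply: (trigger_derive (is_derive_pullback3_1 (spinor_form C v) C0 DC' i j k)).
have hE a b : h a b = h b a by rewrite -[in LHS]hs mxE.
rewrite sym_actionE.
have e1 l (F : 'I_7 -> R) : \sum_p D p l * F p = 2^-1 * \sum_p h l p * F p.
  by rewrite mulr_sumr; apply: eq_bigr => p _; rewrite mxE hE mulrA.
rewrite !e1.
under [X in _ + 2^-1 * X + _]eq_bigr => p _ do rewrite spinor_form_cyc.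
under [X in _ + 2^-1 * X]eq_bigr => p _ do rewrite -spinor_form_cyc.
by field.
Qed.

End PullbackDerivative.

(** * Orthogonality of Spin(7) and equivariance of the spinor form *)

Section SpinElements.
Context (R : realType) (C : clifford_module R).

Lemma tr_cliff X : (cliff C X)^T = - cliff C X.
Proof.
by rewrite /cliff linear_sum -sumrN; apply: eq_bigr => a _; rewrite linearZ /= gam_skew scalerN.
Qed.

Lemma cliff_sq X : cliff C X *m cliff C X = - (dotp X X)%:M.
Proof.
have e : cliff C X *m cliff C X = \sum_a \sum_b (X *m X^T) a b *: (gam C a *m gam C b).
  rewrite {1}/cliff mulmx_suml; apply: eq_bigr => a _.
  rewrite mulmx_sumr; apply: eq_bigr => b _.
  by rewrite -scalemxAl -scalemxAr scalerA mxE big_ord1 mxE.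
by rewrite e sum_sym_gam ?trmx_mul ?trmxK // mxtrace_outer.
Qed.

Lemma Spin7_orth u : Spin7 C u -> u^T *m u = 1%:M.
Proof.
move=> [s [_ s1 ->]]; elim: s s1 => [|X s IH] s1; first by rewrite big_nil trmx1 mulmx1.
rewrite big_cons trmx_mul -mulmxA (mulmxA _^T (cliff C X)) tr_cliff mulNmx cliff_sq opprK.
rewrite s1 ?mem_head // mul1mx IH // => Y Ys; apply: s1.
by rewrite in_cons Ys orbT.
Qed.

Lemma dotp_orth n (u : 'M[R]_n) v w : u^T *m u = 1%:M -> dotp (u *m v) (u *m w) = dotp v w.
Proof. by move=> uu; rewrite dotp_mulmx mulmxA uu mul1mx. Qed.

Lemma cliff_delta a : cliff C (delta_mx a 0) = gam C a.
Proof.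
rewrite /cliff (bigD1 a) //= mxE !eqxx scale1r big1 ?addr0 // => b ba.
by rewrite mxE (negbTE ba) scale0r.
Qed.

(** Each gamma passes through u at the cost of a rotation by r, and u then drops out of the scalar
    product. This makes [Omega] independent of the representative. *)
Lemma spinor_form_equivariant (u : 'M[R]_8) (r : 'M[R]_7) v :
  u^T *m u = 1%:M -> r^T *m r = 1%:M ->
  (forall X, u *m cliff C X = cliff C (r *m X) *m u) ->
  pullback3 r (spinor_form C (u *m v)) = spinor_form C v.
Proof.
move=> uu rr ur; have rrT : r *m r^T = 1%:M by apply: mulmx1C.
have gu a : gam C a *m u = u *m gam_pull C r a.
  have -> : gam_pull C r a = cliff C (r^T *m delta_mx a 0).
    rewrite /gam_pull /cliff; apply: eq_bigr => i _; congr (_ *: _).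
    by rewrite -colE !mxE.
  by rewrite ur mulmxA rrT mul1mx cliff_delta.
have -> : spinor_form C (u *m v) = pullback3 r^T (spinor_form C v).
  apply: funext => a; apply: funext => b; apply: funext => c.
  have guX i X : gam C i *m (u *m X) = u *m (gam_pull C r i *m X :> 'cV_8).
    by rewrite !mulmxA gu.
  have pX i X : gam_pull C r i *m X = \sum_j r i j *: (gam C j *m X) :> 'cV_8.
    by rewrite mulmx_suml; apply: eq_bigr => j _; rewrite -scalemxAl.
  rewrite {1}/spinor_form !guX dotp_orth // pX dotp_suml; apply: eq_bigr => i _.
  rewrite dotpZl pX mulmx_sumr dotp_suml mulr_sumr; apply: eq_bigr => j _.
  rewrite -scalemxAr dotpZl pX !mulmx_sumr dotp_suml !mulr_sumr; apply: eq_bigr => k _.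
  by rewrite -!scalemxAr dotpZl -/(spinor_form C v i j k) !mxE; ring.
by rewrite pullback3M rr pullback3_1.
Qed.

End SpinElements.

(** * Spinor classes, positive forms and their metrics *)

Section SpinorBundle.
Context (R : realType) (C : clifford_module R) (G : universal_cover_GLp R)
  (K : spin_identification C G) (M : closed_manifold7 R) (S : spin_structure G M).
Implicit Types (sigma : S) (v : 'cV[R]_8) (s : Sigma K S) (x : M).

Local Notation coframe sigma := (invmx (frame sigma)).

Lemma frame_unit sigma : frame sigma \in unitmx.
Proof. by rewrite unitmxE unitfE gt_eqF //; exact: frame_oriented. Qed.

Lemma coframe_unit sigma : coframe sigma \in unitmx.
Proof. by rewrite unitmx_inv frame_unit. Qed.

Lemma coframe_det sigma : 0 < \det (coframe sigma).
Proof. by rewrite det_inv invr_gt0; exact: frame_oriented. Qed.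

Lemma spinor_class_eq sigma sigma' v v' :
  spinor_class K sigma v = spinor_class K sigma' v' ->
  exists k : G, [/\ spin_subgroup k, sigma' = sact sigma k & v = kappa K k *m v'].
Proof. by rewrite /spinor_class => /eqmodP/asboolP. Qed.

Lemma spinor_class_sact sigma (k : G) v : spin_subgroup k ->
  spinor_class K (sact sigma k) v = spinor_class K sigma (kappa K k *m v).
Proof. by move=> kk; apply/esym; rewrite /spinor_class; apply/eqmodP/asboolP; exists k. Qed.

Lemma spinor_class_repr s : spinor_class K (repr s).1 (repr s).2 = s.
Proof. by rewrite /spinor_class -surjective_pairing reprK. Qed.

Lemma kappa_orth (k : G) : spin_subgroup k -> (kappa K k)^T *m kappa K k = 1%:M.
Proof. by move=> kk; apply: (@Spin7_orth _ C); have [+ _ _] := kappa_bij K; exact. Qed.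

Lemma spinor_class_invariants sigma sigma' v v' :
  spinor_class K sigma v = spinor_class K sigma' v' ->
  [/\ base sigma = base sigma', dotp v v = dotp v' v',
      (coframe sigma)^T *m coframe sigma = (coframe sigma')^T *m coframe sigma'
    & pullback3 (coframe sigma) (spinor_form C v)
      = pullback3 (coframe sigma') (spinor_form C v')].
Proof.
move=> /esym/spinor_class_eq[k [kk es ->]]; have [rr dr] := kk.
have uk := kappa_orth kk.
have ur : rho k \in unitmx by rewrite unitmxE dr unitr1.
have ec : coframe sigma' = rho k *m coframe sigma.
  apply: (can_inj (mulKmx (frame_unit sigma'))); rewrite mulmxV ?frame_unit // mulmxA.
  by rewrite -frame_sact -es mulmxV ?frame_unit.
split.
- by rewrite es base_sact.
- by rewrite dotp_orth.
- by rewrite ec trmx_mul -mulmxA (mulmxA (rho k)^T) rr mul1mx.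
- rewrite ec -pullback3M (spinor_form_equivariant v uk rr) // => X.
  exact: kappa_cliff.
Qed.

(** Frees the definitions from [repr]: all four quantities may be computed on any representative. *)
Lemma spinor_classE sigma v (s := spinor_class K sigma v) :
  [/\ sbase s = base sigma, spinor_norm s = Num.sqrt (dotp v v),
      metric s = (coframe sigma)^T *m coframe sigma
    & Omega s = pullback3 (coframe sigma) (spinor_form C v)].
Proof.
have := spinor_class_repr s; rewrite {2}/s => /spinor_class_invariants[e1 e2 e3 e4].
by rewrite /sbase /spinor_norm /metric e1 e2 e3 -e4.
Qed.

Lemma Omega_class sigma v :
  Omega (spinor_class K sigma v) = pullback3 (coframe sigma) (spinor_form C v).
Proof. by have [] := spinor_classE sigma v. Qed.

Lemma metric_class sigma v :
  metric (spinor_class K sigma v) = (coframe sigma)^T *m coframe sigma.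
Proof. by have [] := spinor_classE sigma v. Qed.

Lemma Sigma1_class x sigma v :
  Sigma1 x (spinor_class K sigma v) <-> base sigma = x /\ dotp v v = 1.
Proof.
have [eb en _ _] := spinor_classE sigma v; rewrite /Sigma1 /= eb en.
split=> -[-> e]; split => //; last by rewrite e sqrtr1.
have vv0 : 0 <= dotp v v by rewrite dotpE sumr_ge0 // => i _; rewrite -expr2 sqr_ge0.
by rewrite -(sqr_sqrtr vv0) e expr1n.
Qed.

Lemma Lambda3p_Omega x w : Lambda3p K S x w -> exists2 s : Sigma K S, Sigma1 x s & Omega s = w.
Proof.
move=> [s [A [s1 A0 ->]]]; move: s1; rewrite -(spinor_class_repr s).
move: (repr s).1 (repr s).2 => sigma v /Sigma1_class[bx v1].
have uA : A \in unitmx by rewrite unitmxE unitfE gt_eqF.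
(* The frame is to become A^-1 [frame sigma], so that the coframe gains A on the right. [rho] is
   equivariant on the right of the frame, hence the conjugation. *)
pose B := coframe sigma *m invmx A *m frame sigma.
have [_ rho_surj _ _] := rho_covering G.
have [|k _ kB] := rho_surj B.
  rewrite /GLp /= !det_mulmx !det_inv mulrAC mulVf ?mul1r ?invr_gt0 //.
  by rewrite gt_eqF //; exact: frame_oriented.
exists (spinor_class K (sact sigma k) v).
  by apply/Sigma1_class; rewrite base_sact.
rewrite !Omega_class pullback3M; congr (pullback3 _ _).
rewrite frame_sact kB /B !mulmxA mulmxV ?frame_unit // mul1mx.
apply: (can_inj (mulKmx (_ : invmx A *m frame sigma \in unitmx))).
  by rewrite unitmx_mul unitmx_inv uA frame_unit.
rewrite mulmxV ?unitmx_mul ?unitmx_inv ?uA ?frame_unit //.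
by rewrite -mulmxA (mulmxA (frame sigma)) mulmxV ?frame_unit // mul1mx mulVmx.
Qed.

Lemma Omega_Lambda3p x s : Sigma1 x s -> Lambda3p K S x (Omega s).
Proof.
by move=> s1; exists s, 1%:M; split; rewrite ?pullback3_1 // /GLp /= det1 ltr01.
Qed.

(** [get] may select another preimage of the same form; [metric_spinor_form_inj] says that its
    metric agrees. *)
Lemma metric_of_Omega x s : Sigma1 x s -> metric_of K S x (Omega s) = metric s.
Proof.
move=> s1; rewrite /metric_of.
have : [set g | exists s', [/\ Sigma1 x s', Omega s' = Omega s & metric s' = g]] (metric s).
  by exists s.
move=> /getI; set g := get _ => -[s' [s1' es <-]].
move: s1 s1' es; rewrite -(spinor_class_repr s) -(spinor_class_repr s').
move: (repr s).1 (repr s).2 (repr s').1 (repr s').2 => sigma v sigma' v'.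
move=> /Sigma1_class[_ v1] /Sigma1_class[_ v1']; rewrite !Omega_class !metric_class.
exact: metric_spinor_form_inj (coframe_det _) (coframe_det _).
Qed.

Lemma i_op_class x sigma v h : base sigma = x -> dotp v v = 1 ->
  i_op K S x (Omega (spinor_class K sigma v)) h =
  pullback3 (coframe sigma) (sym_action C v ((frame sigma)^T *m h *m frame sigma)).
Proof.
move=> bx v1; rewrite -sym_action_pullback ?coframe_unit // /i_op.
rewrite metric_of_Omega; last by apply/Sigma1_class.
rewrite metric_class Omega_class.
have -> : (coframe sigma)^T *m ((frame sigma)^T *m h *m frame sigma) *m coframe sigma = h.
  by rewrite !mulmxA -trmx_mul mulmxV ?frame_unit // trmx1 mul1mx mulmxK ?frame_unit.
by [].
Qed.

(** * Horizontal lifts in a frame *)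

Lemma BG_frame sigma (h Cp Cq : 'M[R]_7) (F := frame sigma) :
  posdef Cp -> Cp *m Cp = 1%:M + F^T *m h *m F -> Cp *m Cq = 1%:M ->
  BG ((coframe sigma)^T *m coframe sigma) ((coframe sigma)^T *m coframe sigma + h)
    = F *m Cq *m coframe sigma.
Proof.
move=> Cpos CC CI; set th := coframe sigma; set g := th^T *m th; set g' := g + h.
have uF := frame_unit sigma; have uth := coframe_unit sigma.
have thF : th *m F = 1%:M by rewrite mulVmx.
have Fth : F *m th = 1%:M by rewrite mulmxV.
pose P := Cp *m Cp.
have uC := posdef_unit Cpos.
have uP : P \in unitmx by rewrite unitmx_mul uC.
have g'E : g' = th^T *m P *m th.
  rewrite /P CC mulmxDr mulmxDl mulmx1; congr (_ + _).
  by rewrite !mulmxA -trmx_mul Fth trmx1 mul1mx -mulmxA Fth mulmx1.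
have ug' : g' \in unitmx by rewrite g'E !unitmx_mul unitmx_tr uth uC.
have inv_of (B : 'M[R]_7) : B *m B = invmx g' *m g ->
    P *m ((th *m B *m F) *m (th *m B *m F)) = 1%:M.
  move=> BB; have -> : th *m B *m F *m (th *m B *m F) = th *m (B *m B) *m F.
    by rewrite !mulmxA -(mulmxA (th *m B)) Fth mulmx1.
  apply: (can_inj (mulKmx (_ : th^T \in unitmx))); first by rewrite unitmx_tr.
  apply: (can_inj (mulmxK uth)).
  have -> : th^T *m (P *m (th *m (B *m B) *m F)) *m th = g' *m (B *m B) *m (F *m th).
    by rewrite g'E !mulmxA.
  by rewrite BB Fth mulmx1 mulmx1 mulKVmx.
have PCq : P *m Cq = Cp by rewrite /P -mulmxA CI mulmx1.
(* In the frame F the metric g is the identity and g' is P = Cp^2, so the root of g'^-1 g is the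
   inverse Cq of Cp. *)
pose B0 := F *m Cq *m th.
have B0P : posdef (g' *m B0) /\ B0 *m B0 = invmx g' *m g.
  split.
    have -> : g' *m B0 = th^T *m Cp *m th.
      have -> : g' *m B0 = th^T *m (P *m (th *m F) *m Cq) *m th by rewrite g'E /B0 !mulmxA.
      by rewrite thF mulmx1 PCq.
    exact: posdef_congr.
  apply: (can_inj (mulKmx ug')); rewrite mulKVmx // g'E /B0.
  have -> : th^T *m P *m th *m (F *m Cq *m th *m (F *m Cq *m th))
     = th^T *m (P *m (th *m F) *m Cq *m (th *m F) *m Cq) *m th by rewrite !mulmxA.
  by rewrite thF !mulmx1 PCq CI mulmx1.
have /getI : [set B | posdef (g' *m B) /\ B *m B = invmx g' *m g] B0 by [].
rewrite -/(BG g g'); set B := BG g g' => -[Bpos BB].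
have H := inv_of B BB; set B' := th *m B *m F in H.
have uB' : B' \in unitmx.
  by have [_] := mulmx1_unit H; rewrite unitmx_mul => /andP[].
have PB' : P *m B' = invmx B' 
  by apply: (can_inj (mulmxK uB')); rewrite -mulmxA H mulVmx.
have Bp : posdef (P *m B').
  have -> : P *m B' = F^T *m (g' *m B) *m F.
    by rewrite g'E /B' !mulmxA -trmx_mul thF trmx1 mul1mx.
  exact: posdef_congr.
(* Uniqueness: P B' is the inverse of B', so its square is P; being positive it must be Cp, whence
   B' = Cq. *)
have sq : (P *m B') *m (P *m B') = Cp *m Cp.
  by rewrite {2}PB' mulmxK.
have B'E : B' = Cq.
  by apply: (can_inj (mulKmx uP)); rewrite PCq (posdef_sqr_inj Bp Cpos sq).
by rewrite -B'E /B' !mulmxA Fth mul1mx -mulmxA Fth mulmx1.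
Qed.

Lemma rho1 : rho (1%g : G) = 1%:M.
Proof.
have [orth _] := spin_subgroup1 G; have e := rhoM (1%g : G) 1%g; rewrite mulg1 in e.
by rewrite -[LHS]mul1mx -orth -mulmxA -e.
Qed.

(** Along a lift the frame moves by Cq and the coframe by its inverse Cp. Forms and metrics are
    computed from the coframe, so only the derivative of Cp is recorded. *)
Lemma horizontal_liftP sigma (h : 'M[R]_7) : h^T = h ->
  exists Cp Cq : R -> 'M[R]_7,
    [/\ Cp 0 = 1%:M,
        forall i j, is_derive (0 : R) 1 (fun t => Cp t i j)
                      (2^-1 * ((frame sigma)^T *m h *m frame sigma) i j),
        \forall t \near (0 : R), [/\ (Cp t)^T = Cp t, Cp t *m Cq t = 1%:M,
           Cp t *m Cp t = 1%:M + t *: ((frame sigma)^T *m h *m frame sigma)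
           & {for t, continuous Cq}]
      & \forall t \near (0 : R),
          BG ((coframe sigma)^T *m coframe sigma)
             ((coframe sigma)^T *m coframe sigma + t *: h) *m frame sigma
          = frame sigma *m Cq t].
Proof.
move=> hs; set F := frame sigma.
have hFs : (F^T *m h *m F)^T = F^T *m h *m F by rewrite !trmx_mul trmxK hs mulmxA.
have [Cp [Cq [H Cp0 dCp]]] := sqrt_path hFs.
exists Cp, Cq; split => //.
  by apply: filterS H => t [[Cs _] CC CI cq].
apply: filterS H => t [Cpos CC CI _].
rewrite (BG_frame (Cp := Cp t) (Cq := Cq t)) //.
  by rewrite -mulmxA mulVmx ?mulmx1 // frame_unit.
by rewrite CC -scalemxAr -scalemxAl.
Qed.

Lemma horizontal_lift_coframe sigma (h : 'M[R]_7) (l : R -> S) : h^T = h ->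
  horizontal_lift sigma ((coframe sigma)^T *m coframe sigma) h l ->
  exists Cp : R -> 'M[R]_7,
    [/\ Cp 0 = 1%:M,
        forall i j, is_derive (0 : R) 1 (fun t => Cp t i j)
                      (2^-1 * ((frame sigma)^T *m h *m frame sigma) i j)
      & \forall t \near (0 : R), [/\ coframe (l t) = Cp t *m coframe sigma, (Cp t)^T = Cp t
           & Cp t *m Cp t = 1%:M + t *: ((frame sigma)^T *m h *m frame sigma)]].
Proof.
move=> hs [l0 Hl]; have [Cp [Cq [Cp0 dCp HC HB]]] := horizontal_liftP sigma hs.
exists Cp; split => //; apply: filterS3 Hl HC HB => t [_ _ fl] [Cs CI CC _] fB.
split => //; apply: (can_inj (mulmxK (frame_unit (l t)))).
rewrite mulVmx ?frame_unit // fl fB -mulmxA (mulmxA (coframe sigma)) mulVmx ?frame_unit //.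
by rewrite mul1mx.
Qed.

Lemma horizontal_Omega x sigma v (h : 'M[R]_7) (l : R -> S) i j k :
  base sigma = x -> dotp v v = 1 -> h^T = h ->
  horizontal_lift sigma ((coframe sigma)^T *m coframe sigma) h l ->
  is_derive (0 : R) 1 (fun t => Omega (spinor_class K (l t) v) i j k)
    (3 / 2 * i_op K S x (Omega (spinor_class K sigma v)) h i j k).
Proof.
move=> bx v1 hs /(horizontal_lift_coframe hs)[Cp [Cp0 dCp HC]].
have hFs : ((frame sigma)^T *m h *m frame sigma)^T = (frame sigma)^T *m h *m frame sigma.
  by rewrite !trmx_mul trmxK hs mulmxA.
have H a b c := is_derive_sym_action C v hFs Cp0 dCp a b c.
have := is_derive_pullback3 (coframe sigma) H i j k.
rewrite i_op_class // => D.
have e : pullback3 (coframe sigma) (fun a b c => 3 / 2 * sym_action C v ((frame sigma)^T *m h *m frame sigma) a b c) i j k =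
  3 / 2 * pullback3 (coframe sigma) (sym_action C v ((frame sigma)^T *m h *m frame sigma)) i j k.
  rewrite /pullback3 mulr_sumr; apply: eq_bigr => a _; rewrite mulr_sumr; apply: eq_bigr => b _.
  by rewrite mulr_sumr; apply: eq_bigr => c _; ring.
rewrite -e; apply: near_eq_is_derive D.
by apply: filterS HC => t [ct _ _]; rewrite Omega_class ct pullback3M.
Qed.

(** Near 0 the metric is exactly g + t h, since Cp is symmetric with square 1 + t F^T h F. *)
Lemma horizontal_metric sigma v (h : 'M[R]_7) (l : R -> S) i j : h^T = h ->
  horizontal_lift sigma ((coframe sigma)^T *m coframe sigma) h l ->
  is_derive (0 : R) 1 (fun t => metric (spinor_class K (l t) v) i j) (h i j).
Proof.
move=> hs /(horizontal_lift_coframe hs)[Cp [Cp0 dCp HC]].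
set g := (coframe sigma)^T *m coframe sigma.
have D : is_derive (0 : R) 1 (fun t => g i j + t * h i j) (h i j).
  have D1 := is_derive_mul (is_derive_id (0 : R) 1) (is_derive_cst (h i j) (0 : R) 1).
  have := is_deriveD (is_derive_cst (g i j) (0 : R) 1) D1.
  by move/trigger_derive; apply; rewrite /cst; ring.
apply: near_eq_is_derive D; apply: filterS HC => t [ct Cs CC].
have FK : (coframe sigma)^T *m ((frame sigma)^T *m h *m frame sigma) *m coframe sigma = h.
  by rewrite !mulmxA -trmx_mul mulmxV ?frame_unit // trmx1 mul1mx mulmxK ?frame_unit.
rewrite metric_class ct trmx_mul Cs -mulmxA (mulmxA (Cp t)) CC mulmxDl mul1mx mulmxDr -/g.
by rewrite -scalemxAl -scalemxAr mulmxA FK !mxE.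
Qed.

Lemma continuous_sact (T : topologicalType) (l : T -> S) (k : T -> G) t :
  {for t, continuous l} -> {for t, continuous k} ->
  {for t, continuous (fun r => sact (l r) (k r))}.
Proof.
move=> cl ck; have c : (fun r => (l r, k r)) @ t --> (l t, k t) by exact: cvg_pair.
exact: (@cvg_comp _ _ _ (fun r => (l r, k r)) (fun p => sact p.1 p.2) _ _ _ c
          (@sact_cont _ _ _ S (l t, k t))).
Qed.

(** Over a neighbourhood of 1 the sheet of [rho] through the unit has a continuous section q with
    q(1) = 1; acting on sigma by q(Cq t) gives the lift. *)
Lemma horizontal_lift_exists sigma (h : 'M[R]_7) : h^T = h ->
  exists l, horizontal_lift sigma ((coframe sigma)^T *m coframe sigma) h l.
Proof.
move=> hs; have [Cp [Cq [Cp0 dCp HC HB]]] := horizontal_liftP sigma hs.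
have Cq0 : Cq 0 = 1%:M.
  by have [_ CI _ _] := nbhs_singleton HC; rewrite Cp0 mul1mx in CI.
have [_ _ _ cov] := rho_covering G.
have [|V [oV V1 _ [I [W [oW _ WV Wq]]]]] := cov 1%:M; first by rewrite /GLp /= det1 ltr01.
have : (\bigcup_i W i) (1%g : G) by rewrite WV /preimage /= rho1.
move=> [i0 _ Wi1]; have [q [qc qV qK]] := Wq i0.
have q1 : q 1%:M = 1%g by rewrite -rho1 qK.
exists (fun t => sact sigma (q (Cq t))); split; first by rewrite Cq0 q1 sact1.
have cq0 : {for 0, continuous Cq} by have [] := nbhs_singleton HC.
have VC : \forall t \near (0 : R), V (Cq t).
  by apply: cq0; rewrite Cq0; apply: open_nbhs_nbhs.
apply: filterS3 HC HB VC => t [_ _ _ ct] fB Vt.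
split; last by rewrite frame_sact fB; have [_ ->] := qV _ Vt.
- have cqt : {for Cq t, continuous q}.
    by move: qc; rewrite continuous_open_subspace // => /(_ (Cq t)); apply; exact: mem_set.
  have c1 : {for t, continuous (fun r : R => q (Cq r))} by apply: continuous_comp.
  by apply: continuous_sact => //; exact: cvg_cst.
- by rewrite base_sact.
Qed.

(** * Smooth functions and velocities on a fibre *)

Local Notation TFrame := ('M[R]_7 * 'cV[R]_8)%type.

Definition frame_domain : set TFrame := [set p | \det p.1 != 0].

Lemma Ck_fst_coord k (U : set TFrame) i j : Ck k U (fun p => p.1 i j).
Proof.
apply: Ck_linear => [a p q|p]; first by rewrite /= !mxE.
apply: (@continuous_comp _ _ _ (fun p : TFrame => p.1) (fun A : 'M[R]_7 => A i j)).
  exact: cvg_fst.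
exact: coord_continuous.
Qed.

Lemma Ck_snd_coord k (U : set TFrame) i j : Ck k U (fun p => p.2 i j).
Proof.
apply: Ck_linear => [a p q|p]; first by rewrite /= !mxE.
apply: (@continuous_comp _ _ _ (fun p : TFrame => p.2) (fun A : 'cV[R]_8 => A i j)).
  exact: cvg_snd.
exact: coord_continuous.
Qed.

Lemma open_frame_domain : open frame_domain.
Proof.
have c : continuous (fun p : TFrame => \det p.1).
  by move=> p; apply: (@Ck_det _ _ 0 setT) => // [|i j]; [exact: openT|exact: Ck_fst_coord].
have -> : frame_domain = (fun p : TFrame => \det p.1) @^-1` [set y | y != 0] by [].
by apply: open_comp => [p _|]; [exact: c|exact: open_neq].
Qed.

Lemma Ck_coframe k i j : Ck k frame_domain (fun p => invmx p.1 i j).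
Proof. by apply: Ck_invmx => [||a b]; [exact: open_frame_domain| |exact: Ck_fst_coord]. Qed.

Lemma frame_domain_frame sigma v : frame_domain (frame sigma, v).
Proof. by rewrite /frame_domain /= gt_eqF //; exact: frame_oriented. Qed.

Lemma Ck_spinor_form n (U : set TFrame) a b c : open U ->
  Ck n U (fun p => spinor_form C p.2 a b c).
Proof.
move=> oU; pose Q := gam C a *m gam C b *m gam C c.
have -> : (fun p : TFrame => spinor_form C p.2 a b c)
   = fun p => \sum_i (\sum_j Q i j * p.2 j 0) * p.2 i 0.
  apply: funext => p; rewrite /spinor_form !mulmxA -/Q dotpE.
  by apply: eq_bigr => i _; rewrite mxE.
apply: Ck_sum => // i; apply: Ck_mul => //; last exact: Ck_snd_coord.
apply: Ck_sum => // j; apply: Ck_mul => //; first exact: Ck_cst.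
exact: Ck_snd_coord.
Qed.

Lemma smooth_Omega x i j k : smooth_fun x (fun s : Sigma K S => Omega s i j k).
Proof.
move=> sigma0 v0 b0; exists setT, frame_domain.
exists (fun p => pullback3 (invmx p.1) (spinor_form C p.2) i j k); split.
- by split=> //; exact: openT.
- exact: frame_domain_frame.
- split; first exact: open_frame_domain.
  have oU := open_frame_domain.
  move=> n; do 3 (apply: Ck_sum => // ?).
  apply: Ck_mul => //; last exact: Ck_spinor_form.
  apply: Ck_mul => //; last exact: Ck_coframe.
  by apply: Ck_mul => //; exact: Ck_coframe.
- by move=> sigma v _ _ _; rewrite Omega_class.
Qed.

Lemma smooth_metric x i j : smooth_fun x (fun s : Sigma K S => metric s i j).
Proof.
move=> sigma0 v0 b0; exists setT, frame_domain.
exists (fun p => \sum_k invmx p.1 k i * invmx p.1 k j); split.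
- by split=> //; exact: openT.
- exact: frame_domain_frame.
- split; first exact: open_frame_domain.
  have oU := open_frame_domain.
  by move=> n; apply: Ck_sum => // k; apply: Ck_mul => //; exact: Ck_coframe.
- move=> sigma v _ _ _; rewrite metric_class mxE.
  by apply: eq_bigr => k _; rewrite mxE.
Qed.

Lemma continuous_pair (T T1 T2 : topologicalType) (f : T -> T1) (h : T -> T2) t :
  {for t, continuous f} -> {for t, continuous h} -> {for t, continuous (fun r => (f r, h r))}.
Proof. by move=> cf ch; exact: cvg_pair. Qed.

Lemma smooth_fun_lift x (f : Sigma K S -> R) (l : R -> S) (w : R -> 'cV[R]_8) (t : R) :
  smooth_fun x f -> {for t, continuous l} ->
  {for t, continuous (fun r => frame (l r))} -> {for t, continuous w} ->
  (\forall r \near t, base (l r) = x) ->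
  exists (U : set TFrame) (F : TFrame -> R),
    [/\ smooth_on U F, U (frame (l t), w t)
      & \forall r \near t, f (spinor_class K (l r) (w r)) = F (frame (l r), w r)].
Proof.
move=> fs cl cf cw bx.
have [W [U [F [[oW Wl] Ul FU fF]]]] := fs (l t) (w t) (nbhs_singleton bx).
exists U, F; split => //.
have oU : open U by case: FU.
have nW : \forall r \near t, W (l r) by apply: cl; apply: open_nbhs_nbhs.
have cfw : (fun r => (frame (l r), w r) : TFrame) @ t --> ((frame (l t), w t) : TFrame).
  exact: (continuous_pair cf cw).
have nU : \forall r \near t, U (frame (l r), w r) by apply: cfw; apply: open_nbhs_nbhs.
by apply: filterS3 nW nU bx => r ? ? ?; apply: fF.
Qed.

(** A smooth function sees a lift only through its frames, so unique path lifting
    is not needed. *)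
Lemma eq_velocity x (l l' : R -> S) v :
  l 0 = l' 0 -> {for 0, continuous l} -> {for 0, continuous l'} ->
  {for 0, continuous (fun r => frame (l r))} ->
  (\forall r \near (0 : R), [/\ base (l r) = x, base (l' r) = x & frame (l r) = frame (l' r)]) ->
  velocity x (fun t => spinor_class K (l t) v) 0 = velocity x (fun t => spinor_class K (l' t) v) 0.
Proof.
move=> l0 cl cl' cf H; apply: funext => f; rewrite /velocity; case: asboolP => // fs.
have [W [U [F [[oW Wl] Ul [oU _] fF]]]] := fs (l 0) v (let: And3 b _ _ := nbhs_singleton H in b).
have nW : \forall r \near (0 : R), W (l r) by apply: cl; apply: open_nbhs_nbhs.
have nW' : \forall r \near (0 : R), W (l' r).
  by apply: cl'; apply: open_nbhs_nbhs; rewrite -l0.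
have cfw : (fun r => (frame (l r), v) : TFrame) @ (0 : R) --> ((frame (l 0), v) : TFrame).
  exact: (continuous_pair cf (cvg_cst v)).
have nU : \forall r \near (0 : R), U (frame (l r), v) by apply: cfw; apply: open_nbhs_nbhs.
rewrite !derive1E; apply: near_eq_derive.
near=> r; have [bl bl' fl] : [/\ base (l r) = x, base (l' r) = x & frame (l r) = frame (l' r)].
  by near: r.
have Ur : U (frame (l r), v) by near: r.
rewrite /= fF //; last by near: r.
by rewrite fF -?fl //; near: r.
Unshelve. all: by end_near. Qed.

(** [horizontal] ranges over all representatives of the class. The spin group acts on the right of a
    frame and [BG] on the left, so a lift through one representative is carried to a lift through
    any other. *)
Lemma horizontalP x sigma v X : base sigma = x ->
  horizontal x (spinor_class K sigma v) X <->
  exists (h : 'M[R]_7) (l : R -> S),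
    [/\ h^T = h, horizontal_lift sigma ((coframe sigma)^T *m coframe sigma) h l
      & X = velocity x (fun t => spinor_class K (l t) v) 0].
Proof.
move=> bx; split=> [[tau [u [h [l [[bt e] hs [l0 Hl] ->]]]]]|[h [l [hs Hl ->]]]]; last first.
  by exists sigma, v, h, l; rewrite metric_class.
have [k [kk es eu]] := spinor_class_eq (esym e).
rewrite metric_class in Hl.
exists h, (fun t => sact (l t) k); split => //.
  split; first by rewrite l0 -es.
  apply: filterS Hl => t [cl bl fl]; split.
  - by apply: continuous_sact => //; exact: cvg_cst.
  - by rewrite base_sact bl bt bx.
  - by rewrite frame_sact fl -mulmxA -frame_sact -es.
by congr velocity; apply: funext => t; rewrite spinor_class_sact // -eu.
Qed.

Lemma velocity_Omega x sigma v (h : 'M[R]_7) (l : R -> S) :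
  base sigma = x -> dotp v v = 1 -> h^T = h ->
  horizontal_lift sigma ((coframe sigma)^T *m coframe sigma) h l ->
  dOmega (velocity x (fun t => spinor_class K (l t) v) 0)
    = fun i j k => 3 / 2 * i_op K S x (Omega (spinor_class K sigma v)) h i j k.
Proof.
move=> bx v1 hs Hl; apply: funext => i; apply: funext => j; apply: funext => k.
rewrite /dOmega /velocity asboolT; last exact: smooth_Omega.
by rewrite derive1E; have [_ ->] := horizontal_Omega i j k bx v1 hs Hl.
Qed.

Lemma i_opZ x w a (h : 'M[R]_7) :
  i_op K S x w (a *: h) = fun i j k => a * i_op K S x w h i j k.
Proof.
apply: funext => i; apply: funext => j; apply: funext => k.
have e p q r : \sum_i \sum_j (a *: h) p i * invmx (metric_of K S x w) i j * w j q r
  = a * \sum_i \sum_j h p i * invmx (metric_of K S x w) i j * w j q r.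
  rewrite mulr_sumr; apply: eq_bigr => c _; rewrite mulr_sumr; apply: eq_bigr => d _.
  by rewrite mxE; ring.
by rewrite /i_op /skew3 !e; ring.
Qed.

Lemma i_op_inj x sigma v (h k : 'M[R]_7) : base sigma = x -> dotp v v = 1 ->
  h^T = h -> k^T = k ->
  i_op K S x (Omega (spinor_class K sigma v)) h = i_op K S x (Omega (spinor_class K sigma v)) k ->
  h = k.
Proof.
move=> bx v1 hs ks; rewrite !i_op_class // => /(pullback3_inj (coframe_unit sigma)).
move=> /(sym_action_inj v1) e.
have {}e : (frame sigma)^T *m h *m frame sigma = (frame sigma)^T *m k *m frame sigma.
  by apply: e; rewrite !trmx_mul trmxK ?hs ?ks mulmxA.
apply: (can_inj (mulKmx (_ : (frame sigma)^T \in unitmx))).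
  by rewrite unitmx_tr frame_unit.
exact: (can_inj (mulmxK (frame_unit sigma))).
Qed.

Lemma continuous_mulmx (T : topologicalType) n (B : 'M[R]_n.+1) (Q : T -> 'M[R]_n.+1) t :
  {for t, continuous Q} -> {for t, continuous (fun r => B *m Q r)}.
Proof.
move=> cQ; apply: continuous_mxP => i j.
have -> : (fun r => (B *m Q r) i j) = (fun A : 'M[R]_n.+1 => \sum_k B i k * A k j) \o Q.
  by apply: funext => r; rewrite mxE.
have c0 : Ck 0 setT (fun A : 'M[R]_n.+1 => \sum_k B i k * A k j).
  apply: Ck_sum => [|k]; first exact: openT.
  apply: Ck_mul; [exact: openT|exact: Ck_cst|].
  by apply: Ck_linear => [a A A'|]; [rewrite !mxE|exact: coord_continuous].
by apply: continuous_comp; [exact: cQ|exact: c0].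
Qed.

Lemma horizontal_lift_velocity_eq x sigma v (h : 'M[R]_7) (l l' : R -> S) :
  base sigma = x -> h^T = h ->
  horizontal_lift sigma ((coframe sigma)^T *m coframe sigma) h l ->
  horizontal_lift sigma ((coframe sigma)^T *m coframe sigma) h l' ->
  velocity x (fun t => spinor_class K (l t) v) 0 = velocity x (fun t => spinor_class K (l' t) v) 0.
Proof.
move=> bx hs [l0 Hl] [l0' Hl'].
have [Cp [Cq [_ _ HC HB]]] := horizontal_liftP sigma hs.
have [cl _ _] := nbhs_singleton Hl; have [cl' _ _] := nbhs_singleton Hl'.
apply: eq_velocity => //; first by rewrite l0 l0'.
  have [_ _ _ cq] := nbhs_singleton HC.
  have cF : {for 0, continuous (fun r => frame sigma *m Cq r)}.
    exact: continuous_mulmx.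
  rewrite /prop_for /continuous_at.
  have nE : \forall r \near (0 : R), frame sigma *m Cq r = frame (l r).
    by apply: filterS2 Hl HB => r [_ _ ->] ->.
  rewrite -(nbhs_singleton nE); apply: cvg_trans cF; exact: near_eq_cvg.
by apply: filterS2 Hl Hl' => r [_ bl fl] [_ bl' fl']; rewrite bl bl' fl fl' bx.
Qed.

(** Both spaces are parametrised by symmetric h. Injectivity: the velocity of the form determines h
    by [i_op_inj], and h determines the derivation since any two lifts in its direction agree. The
    factor 2/3 in surjectivity undoes the 3/2. *)
Lemma horizontal_bij x s : Sigma1 x s ->
  set_bij (horizontal x s) (Lambda28 K S x (Omega s)) (@dOmega _ _ _ K _ S).
Proof.
rewrite -(spinor_class_repr s); move: (repr s).1 (repr s).2 => sigma v.
move=> /Sigma1_class[bx v1]; set w := Omega _.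
split.
- move=> X /(horizontalP _ _ bx)[h [l [hs Hl ->]]]; rewrite (velocity_Omega bx v1 hs Hl).
  exists (3 / 2 *: h); last by rewrite i_opZ.
  by rewrite /symmetric2 linearZ /= hs.
- move=> X Y; rewrite !inE => /(horizontalP _ _ bx)[h [l [hs Hl ->]]].
  move=> /(horizontalP _ _ bx)[h' [l' [hs' Hl' ->]]].
  rewrite (velocity_Omega bx v1 hs Hl) (velocity_Omega bx v1 hs' Hl').
  rewrite -!i_opZ => /(i_op_inj bx v1) e.
  have {}e : h = h'.
    have /scalerI : 3 / 2 *: h = 3 / 2 *: h' by apply: e; rewrite linearZ /= ?hs ?hs'.
    by apply; rewrite mulf_eq0 invr_eq0 !pnatr_eq0.
  by move: Hl'; rewrite -e; exact: horizontal_lift_velocity_eq.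
- move=> _ [h hs <-].
  have hs' : (2 / 3 *: h)^T = 2 / 3 *: h by rewrite linearZ /= hs.
  have [l Hl] := horizontal_lift_exists sigma hs'.
  exists (velocity x (fun t => spinor_class K (l t) v) 0).
    by apply/(horizontalP _ _ bx); exists (2 / 3 *: h), l.
  rewrite (velocity_Omega bx v1 hs' Hl) -i_opZ scalerA.
  by rewrite (_ : _ * _ = 1) ?scale1r //; field.
Qed.

Lemma smooth_curve_derivable x I (c : R -> Sigma K S) (f : Sigma K S -> R) (t : R) :
  smooth_curve x I c -> I t -> smooth_fun x f -> derivable (fun r => f (c r)) t 1.
Proof.
move=> sc It fs; have [U [l [v [Ut [oU sl] [_ sv] H]]]] := sc t It.
have nU : \forall r \near t, U r by apply: open_nbhs_nbhs.
have [dl _] := sl 1%N; have [dv _] := sv 1%N.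
have [cl _ _] := H t Ut.
have [|V [F [FV Vt fF]]] := @smooth_fun_lift x f l v t fs cl
    (differentiable_continuous (dl t Ut)) (differentiable_continuous (dv t Ut)).
  by apply: filterS nU => r /H[].
have [_ /(_ 1%N)[dF _]] := FV.
have D : derivable (fun r => F (frame (l r), v r)) t 1.
  apply/derivable1_diffP.
  apply: (@differentiable_comp _ _ _ _ (fun r => (frame (l r), v r) : TFrame) F).
    by apply: differentiable_pair; [exact: dl|exact: dv].
  exact: dF.
apply: near_eq_derivable D.
by apply: filterS2 nU fF => r /H[_ _ ->] ->.
Qed.

(** At time t the curve and some horizontal lift define the same derivation. Tested on the
    components of the metric it identifies h with the derivative of the metric; tested on those of
    [Omega] it gives 3/2 i(h). *)
Lemma horizontal_curve_derive x a b (c : R -> Sigma K S) : horizontal_curve x a b c ->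
  forall t : R, t \in `]a, b[ ->
    derivable (fun u => metric (c u)) t 1 /\
    forall i j k : 'I_7,
      is_derive t 1 (fun u => Omega (c u) i j k)
        (3 / 2 * i_op K S x (Omega (c t)) (derive1 (fun u => metric (c u)) t) i j k).
Proof.
move=> [sc Hc] t tab; have [s1 hor] := Hc t tab.
have It : `]a, b[%classic t by [].
have dm i j : derivable (fun u => metric (c u) i j) t 1.
  exact: smooth_curve_derivable sc It (smooth_metric i j).
have dO i j k : derivable (fun u => Omega (c u) i j k) t 1.
  exact: smooth_curve_derivable sc It (smooth_Omega i j k).
have dM : derivable (fun u => metric (c u)) t 1 by apply/derivable_mxP.
split => // i j k.
have [sigma [v cE]] : exists sigma v, c t = spinor_class K sigma v.
  by exists (repr (c t)).1, (repr (c t)).2; rewrite spinor_class_repr.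
move: s1 hor; rewrite cE => /Sigma1_class[bx v1] /(horizontalP _ _ bx)[h [l [hs Hl vE]]].
have dmE : derive1 (fun u => metric (c u)) t = h.
  rewrite derive1E derive_mx //; apply/matrixP => p q; rewrite mxE.
  have := congr1 (fun X => X (fun s => metric s p q)) vE.
  rewrite /velocity asboolT; last exact: smooth_metric.
  by rewrite !derive1E; have [_ ->] := horizontal_metric v p q hs Hl.
rewrite dmE; split => //.
have := congr1 (fun X => X (fun s => Omega s i j k)) vE.
rewrite /velocity asboolT; last exact: smooth_Omega.
by rewrite !derive1E => ->; have [_ ->] := horizontal_Omega i j k bx v1 hs Hl.
Qed.

(** * Differentiating the wedge relation, and non-integrability *)

Lemma wedge_pairingE (b w : form3 R) xi :
  wedge_pairing C b w xi = \sum_i \sum_j \sum_k b i j k * \sum_p \sum_q \sum_r w p q r *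
    \tr (gam C p *m gam C q *m gam C r *m ((\sum_i xi i *: gam C i) *m
           (gam C i *m gam C j *m gam C k))).
Proof.
rewrite /wedge_pairing mxtrace_sum3; do 3 (apply: eq_bigr => ? _); congr (_ * _).
by rewrite mxtrace_mulC -[X in \tr X]mulmxA mxtrace_sum3.
Qed.

Lemma is_derive_wedge_pairing (V : normedModType R) (b w : V -> form3 R) (db dw : form3 R) xi u y :
  (forall i j k, is_derive u y (fun p => b p i j k) (db i j k)) ->
  (forall i j k, is_derive u y (fun p => w p i j k) (dw i j k)) ->
  is_derive u y (fun p => wedge_pairing C (b p) (w p) xi)
    (wedge_pairing C (b u) dw xi + wedge_pairing C db (w u) xi).
Proof.
move=> Hb Hw; rewrite !wedge_pairingE.
have -> : (fun p => wedge_pairing C (b p) (w p) xi) = fun p =>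
   \sum_i \sum_j \sum_k b p i j k * \sum_p0 \sum_q \sum_r w p p0 q r *
    \tr (gam C p0 *m gam C q *m gam C r *m ((\sum_i xi i *: gam C i) *m
           (gam C i *m gam C j *m gam C k))) by apply: funext => p; rewrite wedge_pairingE.
rewrite -big_split; apply: is_derive_bigsum => i.
rewrite -big_split; apply: is_derive_bigsum => j.
rewrite -big_split; apply: is_derive_bigsum => k /=.
rewrite [X in _ + X]mulrC; apply: is_derive_mul => //.
apply: is_derive_bigsum => p; apply: is_derive_bigsum => q; apply: is_derive_bigsum => r.
set c := \tr _; have := is_derive_mul (Hw p q r) (is_derive_cst (c : R) u y).
by rewrite /cst mulr0 add0r mulrC.
Qed.

Lemma Lambda28_wedge x w b y : Lambda3p K S x w -> Lambda28 K S x w b ->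
  wedge_pairing C b w y = 0.
Proof.
move=> /Lambda3p_Omega[s s1 <-]; move: s1; rewrite -(spinor_class_repr s).
move: (repr s).1 (repr s).2 => sigma v /Sigma1_class[bx v1] [h hs <-].
rewrite i_op_class // Omega_class; apply: wedge_pairing_spinor_form => //.
  exact: coframe_unit.
by rewrite !trmx_mul trmxK hs mulmxA.
Qed.

(** On an integral manifold [f] the relation [D_v f /\ f = 0] holds identically;
    since second derivatives commute and the pairing is skew, differentiating it
    gives [D_v f /\ D_w f = 0], which fails on [Lambda28]. *)
Lemma Lambda28_not_integrable x :
  ~ integrable_distribution 28 (Lambda3p K S x) (Lambda28 K S x).
Proof.
have [sigma bx] : exists sigma : S, base sigma = x.
  have [U [s0 [q [[_ Ux] H _ _ _]]]] := sact_trivial S x.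
  by exists (s0 (x, 1%g)); have [] := H x 1%g Ux.
pose v : 'cV[R]_8 := delta_mx 0 0.
have v1 : dotp v v = 1.
  by rewrite /dotp /v trmx_delta mul_delta_mx mxE !eqxx.
set w := Omega (spinor_class K sigma v).
have w3 : Lambda3p K S x w by apply: Omega_Lambda3p; apply/Sigma1_class.
move=> /(_ w w3)[U [f [u0 [Uu0 fu0 sf fP fD]]]].
have oU : open U by have [] := sf 0 0 0.
have cf n i j k : Ck n U (fun u => f u i j k) by have [_] := sf i j k.
pose D (y : 'cV[R]_28) u : form3 R := fun i j k => 'D_y (fun p => f p i j k) u.
have D0 y z u : U u -> wedge_pairing C (D y u) (f u) z = 0.
  move=> Uu; apply: (Lambda28_wedge _ (fP u Uu)).
  by have [+ _ _] := fD u Uu; apply.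
pose D2 y y' : form3 R := fun i j k => 'D_y' ('D_y (fun p => f p i j k)) u0.
have dD y y' i j k : is_derive u0 y' (fun p => D y p i j k) (D2 y y' i j k).
  have [_ /(_ y)[d _]] := cf 2 i j k.
  by split => //; apply: diff_derivable; exact: d.
have df y i j k : is_derive u0 y (fun p => f p i j k) (D y u0 i j k).
  have [d _] := cf 1%N i j k.
  by split => //; apply: diff_derivable; exact: d.
have D2C y y' : D2 y y' = D2 y' y.
  by do 3 apply: funext => ?; apply: (derive_comm _ _ oU).
have rel y y' z : wedge_pairing C (D y u0) (D y' u0) z + wedge_pairing C (D2 y y') (f u0) z = 0.
  have d1 := is_derive_wedge_pairing z (dD y y') (df y').
  have d0 : is_derive u0 y' (fun p => wedge_pairing C (D y p) (f p) z) 0.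
    apply: near_eq_is_derive (is_derive_cst (0 : R) u0 y').
    by apply: filterS (open_nbhs_nbhs (conj oU Uu0)) => u Uu; rewrite D0.
  by rewrite -(@derive_val _ _ _ _ _ _ _ d1) (@derive_val _ _ _ _ _ _ _ d0).
clearbody D2.
have cancel_eq (a a' b b' : R) : a + b = 0 -> a' + b' = 0 -> b = b' -> a = a'.
  by move=> e e' be; move: e; rewrite be -e' => /addIr.
have sym y y' z : wedge_pairing C (D y u0) (D y' u0) z = wedge_pairing C (D y' u0) (D y u0) z.
  exact: cancel_eq (rel y y' z) (rel y' y z)
    (congr1 (fun T => wedge_pairing C T (f u0) z) (D2C y y')).
have [h [k [z [hs ks]]]] := wedge_pairing_neq0 C v1 (coframe_unit sigma).
(* The tangent space at u0 is all of [Lambda28], so the pair with nonzero pairing is realised by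
   tangent directions. *)
have inL (m : 'M[R]_7) : m^T = m ->
    exists y, D y u0 = pullback3 (coframe sigma) (sym_action C v m).
  move=> ms; have [_ _ /(_ (pullback3 (coframe sigma) (sym_action C v m)))] := fD u0 Uu0.
  case=> [|y _ <-]; last by exists y.
  rewrite fu0; exists ((coframe sigma)^T *m m *m coframe sigma).
    by rewrite /symmetric2 !trmx_mul trmxK ms mulmxA.
  rewrite i_op_class //; congr (pullback3 _ (sym_action _ _ _)).
  by rewrite !mulmxA -trmx_mul mulVmx ?frame_unit // trmx1 mul1mx mulmxKV ?frame_unit.
have [y yE] := inL h hs; have [y' yE'] := inL k ks.
have := sym y y' z; rewrite yE yE' wedge_pairing_skew ?coframe_unit //.
by set X := wedge_pairing _ _ _ _ => e /eqP; apply; lra.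
Qed.

End SpinorBundle.

Theorem lemma4p1 (R : realType) (C : clifford_module R)
    (G : universal_cover_GLp R) (K : spin_identification C G)
    (M : closed_manifold7 R) (S : spin_structure G M) :
  (forall (x : M) (w : form3 R), Lambda3p K S x w ->
     (exists2 s : Sigma K S, Sigma1 x s & Omega s = w) /\
     (forall s : Sigma K S, Sigma1 x s -> Omega s = w ->
        set_bij (horizontal x s) (Lambda28 K S x w) (@dOmega _ _ _ K _ S))) /\
  (forall x : M,
     ~ integrable_distribution 28 (Lambda3p K S x) (Lambda28 K S x)) /\
  (forall (x : M) (a b : R) (c : R -> Sigma K S), horizontal_curve x a b c ->
     forall t : R, t \in `]a, b[ ->
       derivable (fun u => metric (c u)) t 1 /\
       forall i j k : 'I_7,
         is_derive t 1 (fun u => Omega (c u) i j k)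
           (3 / 2 * i_op K S x (Omega (c t))
                      (derive1 (fun u => metric (c u)) t) i j k)).
Proof.
split; [|split].
- move=> x w Pw; split; first exact: Lambda3p_Omega Pw.
  by move=> s s1 <-; exact: horizontal_bij.
- exact: Lambda28_not_integrable.
- exact: horizontal_curve_derive.
Qed.
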